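(* Let $g\in \mathcal H^\infty(B_{\ell_2},\ell_2)$ with $\|g\|<1$. Then there is an analytic injection $$\Psi_g: B_{\mathcal H^\infty(B_{\ell_2},\ell_2)}\to \mathscr F(g),$$ where $B_{\mathcal H^\infty(B_{\ell_2},\ell_2)}$ is the open unit ball of $\mathcal H^\infty(B_{\ell_2},\ell_2)$ and $\mathscr F(g)\subset\mathcal M_{u,\infty}(B_{\ell_2},B_{\ell_2})$ is the fiber over $g$.
   Context: All spaces are complex and $B_{\ell_2}$ is the open unit ball of $\ell_2$. $\mathcal A_u(B_{\ell_2})$ is the Banach algebra (sup norm) of holomorphic functions $f:B_{\ell_2}\to\mathbb C$ that are uniformly continuous on $B_{\ell_2}$. $\mathcal H^\infty(B_{\ell_2})$ is the Banach algebra of bounded holomorphic functions $B_{\ell_2}\to\mathbb C$ with the sup norm; $\mathcal H^\infty(B_{\ell_2},\ell_2)$ is the Banach space of bounded holomorphic maps $B_{\ell_2}\to\ell_2$ with the norm $\|g\|=\sup_{x\in B_{\ell_2}}\|g(x)\|$. The vector-valued spectrum is $\mathcal M_{u,\infty}(B_{\ell_2},B_{\ell_2})=\{\Phi:\mathcal A_u(B_{\ell_2})\to\mathcal H^\infty(B_{\ell_2})\ \text{nonzero algebra homomorphism}\}$. With $(e_n)$ the canonical basis of $\ell_2$, the projection $\xi:\mathcal M_{u,\infty}(B_{\ell_2},B_{\ell_2})\to\mathcal H^\infty(B_{\ell_2},\ell_2)$ is $\xi(\Phi)(x)=\big(\Phi(\langle\cdot,e_n\rangle)(x)\big)_n$;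 its image is the closed unit ball of $\mathcal H^\infty(B_{\ell_2},\ell_2)$. The fiber over $g$ is $\mathscr F(g)=\xi^{-1}(g)=\{\Phi\in\mathcal M_{u,\infty}(B_{\ell_2},B_{\ell_2}):\xi(\Phi)=g\}$. A map $\Psi:B_{\mathcal H^\infty(B_{\ell_2},\ell_2)}\to\mathcal M_{u,\infty}(B_{\ell_2},B_{\ell_2})$ is called analytic if for every $f\in\mathcal A_u(B_{\ell_2})$ and $x\in B_{\ell_2}$ the function $h\mapsto\Psi(h)(f)(x)$ is holomorphic on $B_{\mathcal H^\infty(B_{\ell_2},\ell_2)}$. An analytic injection is an injective analytic map. *)

(* Defs.v *)
From Stdlib Require Import Reals Lra Lia Psatz.
From Stdlib Require Import FunctionalExtensionality ProofIrrelevance.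
From Coquelicot Require Import Coquelicot.
Open Scope R_scope.

Lemma plus_minus_r : forall (G : AbelianGroup) (x y : G), plus x (minus y x) = y.
Proof.
  intros G x y. unfold minus.
  rewrite plus_comm, <- plus_assoc.
  eapply eq_trans; [apply f_equal; apply plus_opp_l | apply plus_zero_r].
Qed.

Lemma plus_shuffle : forall (M : AbelianMonoid) (a b c d : M),
  plus (plus a b) (plus c d) = plus (plus a c) (plus b d).
Proof.
  intros M a b c d. rewrite <- !plus_assoc. f_equal.
  rewrite !plus_assoc. f_equal. apply plus_comm.
Qed.

Lemma minus_plus_plus : forall (G : AbelianGroup) (a b c d : G),
  plus (minus a c) (minus b d) = minus (plus a b) (plus c d).
Proof.
  intros G a b c d. unfold minus. eapply eq_trans; [apply plus_shuffle|].
  apply f_equal. symmetry. apply opp_plus.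
Qed.

Lemma scal_minus : forall (V : ModuleSpace C_Ring) (k : C) (x y : V),
  scal k (minus x y) = minus (scal k x) (scal k y).
Proof.
  intros V k x y. unfold minus. eapply eq_trans; [apply scal_distr_l|].
  apply f_equal. apply (scal_opp_r (K := C_Ring)).
Qed.

(* Coquelicot asks for a uniform structure next to the norm; here the balls of
   that structure are always the norm balls. *)
Section NormBalls.

Variables (V : ModuleSpace C_Ring) (N : V -> R).
Hypothesis N_triangle : forall x y, N (plus x y) <= N x + N y.
Hypothesis N_scal : forall (k : C) x, N (scal k x) <= Cmod k * N x.

Lemma N_zero : N zero = 0.
Proof.
  assert (H0 := N_scal (RtoC 0) zero). assert (H1 := N_triangle zero zero).
  rewrite Cmod_0 in H0. rewrite scal_zero_r in H0.
  rewrite plus_zero_l in H1. lra.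
Qed.

Lemma N_opp : forall x, N (opp x) <= N x.
Proof.
  intros x. rewrite <- (scal_opp_one x).
  eapply Rle_trans; [apply N_scal|].
  replace (Cmod (opp one)) with 1. lra.
  change (1 = Cmod (Copp (RtoC 1))). rewrite Cmod_opp, Cmod_1. easy.
Qed.

Lemma norm_ball_center : forall (x : V) (e : posreal), N (minus x x) < e.
Proof. intros x e. rewrite minus_eq_zero.
  eapply Rle_lt_trans; [right; exact N_zero | apply cond_pos].
Qed.

Lemma norm_ball_sym :
  forall (x y : V) (e : R), N (minus y x) < e -> N (minus x y) < e.
Proof.
  intros x y e H. rewrite <- opp_minus.
  eapply Rle_lt_trans; [apply N_opp | exact H].
Qed.

Lemma norm_ball_triangle : forall (x y z : V) (e1 e2 : R),
  N (minus y x) < e1 -> N (minus z y) < e2 -> N (minus z x) < e1 + e2.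
Proof.
  intros x y z e1 e2 H1 H2. rewrite (minus_trans y z x).
  eapply Rle_lt_trans; [apply N_triangle | lra].
Qed.

Definition norm_uniform_mixin : UniformSpace.mixin_of V :=
  UniformSpace.Mixin V zero (fun x e y => N (minus y x) < e)
    norm_ball_center norm_ball_sym norm_ball_triangle.

End NormBalls.

Definition square_summable (u : nat -> C) : Prop :=
  ex_series (fun n => Cmod (u n) ^ 2).

Record ell2 : Type := Ell2 {
  coef :> nat -> C;
  coef_summable : square_summable coef }.

Lemma ell2_ext : forall x y : ell2, (forall n, x n = y n) -> x = y.
Proof.
  intros [u Hu] [v Hv] H; simpl in H.
  assert (E : u = v) by (apply functional_extensionality; exact H).
  subst v. f_equal. apply proof_irrelevance.
Qed.

Lemma ex_series_pos_le : forall a b : nat -> R,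
  (forall n, 0 <= a n <= b n) -> ex_series b -> ex_series a.
Proof.
  intros a b H Hb.
  apply (ex_series_le (K := R_AbsRing) (V := R_CompleteNormedModule) a b); auto.
  intros n. change (Rabs (a n) <= b n). rewrite Rabs_pos_eq; apply H.
Qed.

Lemma ex_series_ext_R : forall a b : nat -> R,
  (forall n, a n = b n) -> ex_series a -> ex_series b.
Proof. intros a b H. apply ex_series_ext. exact H. Qed.

Lemma ex_series_finite : forall (a : nat -> R) (m : nat),
  (forall n, (m <= n)%nat -> a n = 0) -> ex_series a.
Proof.
  intros a m H. apply (ex_series_incr_n a m). exists 0.
  apply is_series_ext with (fun _ => 0).
  - intros n. symmetry. apply H. lia.
  - apply filterlim_ext with (fun _ : nat => 0).
    + intros n. now rewrite sum_n_const, Rmult_0_r.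
    + apply filterlim_const.
Qed.

Lemma Cmod_plus_sqr : forall (t : R) (a b : C), 0 < t ->
  Cmod (a + b) ^ 2 <= (1 + t) * Cmod a ^ 2 + (1 + / t) * Cmod b ^ 2.
Proof.
  intros t a b Ht.
  assert (H := Cmod_triangle a b). assert (Ha := Cmod_ge_0 a).
  assert (Hb := Cmod_ge_0 b). assert (Hab := Cmod_ge_0 (a + b)).
  set (p := Cmod a) in *. set (q := Cmod b) in *.
  apply Rle_trans with ((p + q) ^ 2).
  - apply pow_incr. lra.
  - assert (E : (1 + t) * p ^ 2 + (1 + / t) * q ^ 2 - (p + q) ^ 2
                = (t * p - q) ^ 2 * / t) by (field; lra).
    assert (0 <= (t * p - q) ^ 2 * / t).
    { apply Rmult_le_pos; [apply pow2_ge_0|].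
      left. now apply Rinv_0_lt_compat. }
    lra.
Qed.

Lemma square_summable_lin : forall (s t : R) (u v : nat -> C),
  square_summable u -> square_summable v ->
  ex_series (fun n => s * Cmod (u n) ^ 2 + t * Cmod (v n) ^ 2).
Proof.
  intros s t u v Hu Hv.
  apply (ex_series_plus (fun n => s * Cmod (u n) ^ 2)
                        (fun n => t * Cmod (v n) ^ 2)).
  - now apply (ex_series_scal s (fun n => Cmod (u n) ^ 2)).
  - now apply (ex_series_scal t (fun n => Cmod (v n) ^ 2)).
Qed.

Lemma square_summable_plus : forall u v : nat -> C,
  square_summable u -> square_summable v ->
  square_summable (fun n => u n + v n)%C.
Proof.
  intros u v Hu Hv.
  eapply ex_series_pos_le; [|apply (square_summable_lin (1 + 1) (1 + / 1) u v Hu Hv)].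
  intros n; split; [apply pow2_ge_0|]. apply Cmod_plus_sqr. lra.
Qed.

Lemma square_summable_scal : forall (k : C) (u : nat -> C),
  square_summable u -> square_summable (fun n => k * u n)%C.
Proof.
  intros k u Hu. unfold square_summable.
  apply ex_series_ext_R with (fun n => Cmod k ^ 2 * Cmod (u n) ^ 2).
  - intros n. rewrite Cmod_mult. ring.
  - now apply (ex_series_scal (Cmod k ^ 2) (fun n => Cmod (u n) ^ 2)).
Qed.

Lemma square_summable_opp : forall u : nat -> C,
  square_summable u -> square_summable (fun n => - u n)%C.
Proof.
  intros u Hu. apply ex_series_ext_R with (2 := Hu).
  intros n. now rewrite Cmod_opp.
Qed.

Lemma square_summable_finite : forall (u : nat -> C) (m : nat),
  (forall n, (m <= n)%nat -> u n = RtoC 0) -> square_summable u.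
Proof.
  intros u m H. apply ex_series_finite with m.
  intros n Hn. rewrite H by easy. rewrite Cmod_0. ring.
Qed.

Definition ell2_zero : ell2 :=
  Ell2 (fun _ => RtoC 0) (square_summable_finite (fun _ => RtoC 0) 0 (fun _ _ => eq_refl)).
Definition ell2_plus (x y : ell2) : ell2 :=
  Ell2 (fun n => x n + y n)%C
    (square_summable_plus x y (coef_summable x) (coef_summable y)).
Definition ell2_opp (x : ell2) : ell2 :=
  Ell2 (fun n => - x n)%C (square_summable_opp x (coef_summable x)).
Definition ell2_scal (k : C) (x : ell2) : ell2 :=
  Ell2 (fun n => k * x n)%C (square_summable_scal k x (coef_summable x)).

Definition ell2_AbelianMonoid_mixin : AbelianMonoid.mixin_of ell2.
Proof.
  refine (AbelianMonoid.Mixin ell2 ell2_plus ell2_zero _ _ _);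
    intros; apply ell2_ext; intros n; simpl; ring.
Defined.
Canonical ell2_AbelianMonoid :=
  AbelianMonoid.Pack ell2 ell2_AbelianMonoid_mixin ell2.

Definition ell2_AbelianGroup_mixin : AbelianGroup.mixin_of ell2_AbelianMonoid.
Proof.
  refine (AbelianGroup.Mixin ell2_AbelianMonoid ell2_opp _);
    intros; apply ell2_ext; intros n; simpl; ring.
Defined.
Canonical ell2_AbelianGroup :=
  AbelianGroup.Pack ell2
    (AbelianGroup.Class ell2 ell2_AbelianMonoid_mixin ell2_AbelianGroup_mixin) ell2.

Definition ell2_ModuleSpace_mixin : ModuleSpace.mixin_of C_Ring ell2_AbelianGroup.
Proof.
  refine (ModuleSpace.Mixin C_Ring ell2_AbelianGroup ell2_scal _ _ _ _);
    intros; apply ell2_ext; intros n; simpl;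
    unfold mult, plus, one; simpl; ring.
Defined.
Canonical ell2_ModuleSpace :=
  ModuleSpace.Pack C_Ring ell2
    (ModuleSpace.Class C_Ring ell2 (AbelianGroup.class ell2_AbelianGroup)
       ell2_ModuleSpace_mixin) ell2.

Definition ell2_norm (x : ell2) : R := sqrt (Series (fun n => Cmod (x n) ^ 2)).

Lemma Series_zero : forall a : nat -> R, (forall n, a n = 0) -> Series a = 0.
Proof.
  intros a H. rewrite (Series_ext a (fun n => 0 * a n)).
  - rewrite Series_scal_l. ring.
  - intros n. rewrite (H n). ring.
Qed.

Lemma Series_pos : forall a : nat -> R,
  (forall n, 0 <= a n) -> ex_series a -> 0 <= Series a.
Proof.
  intros a Ha H. rewrite <- (Series_zero (fun _ => 0)) by easy.
  apply Series_le; auto. intros n. split; [lra | apply Ha].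
Qed.

Lemma Series_term_le : forall (a : nat -> R) (n : nat),
  (forall k, 0 <= a k) -> ex_series a -> a n <= Series a.
Proof.
  intros a n Ha H.
  assert (Hs : ex_series (fun k => a (S n + k)%nat)) by now apply ex_series_incr_n.
  rewrite (Series_incr_n a (S n)) by (auto; lia).
  assert (0 <= Series (fun k => a (S n + k)%nat)) by (apply Series_pos; auto).
  simpl pred.
  assert (a n <= sum_f_R0 a n).
  { destruct n; simpl; [lra|].
    assert (0 <= sum_f_R0 a n) by (apply cond_pos_sum; auto). lra. }
  lra.
Qed.

Lemma ell2_norm_pos : forall x, 0 <= ell2_norm x.
Proof. intros x. apply sqrt_pos. Qed.

Lemma ell2_norm_sqr : forall x : ell2,
  ell2_norm x ^ 2 = Series (fun n => Cmod (x n) ^ 2).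
Proof.
  intros x. apply pow2_sqrt. apply Series_pos; [|apply coef_summable].
  intros n. apply pow2_ge_0.
Qed.

Lemma ell2_coef_le : forall (x : ell2) (n : nat), Cmod (x n) <= ell2_norm x.
Proof.
  intros x n. rewrite <- (sqrt_pow2 (Cmod (x n))) by apply Cmod_ge_0.
  apply sqrt_le_1_alt.
  apply (Series_term_le (fun n => Cmod (x n) ^ 2)); [|apply coef_summable].
  intros k. apply pow2_ge_0.
Qed.

Lemma ell2_norm_eq_0 : forall x : ell2, ell2_norm x = 0 -> x = zero.
Proof.
  intros x H. apply ell2_ext. intros n. apply Cmod_eq_0.
  assert (H1 := ell2_coef_le x n). assert (H2 := Cmod_ge_0 (x n)). lra.
Qed.

Lemma ell2_norm_zero : ell2_norm zero = 0.
Proof.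
  unfold ell2_norm. rewrite <- sqrt_0. f_equal. apply Series_zero.
  intros n. simpl. rewrite Cmod_0. ring.
Qed.

Lemma ell2_norm_triangle : forall x y : ell2,
  ell2_norm (plus x y) <= ell2_norm x + ell2_norm y.
Proof.
  intros x y.
  assert (Hx := ell2_norm_pos x). assert (Hy := ell2_norm_pos y).
  destruct (Req_dec (ell2_norm x) 0) as [Ex|Ex].
  { rewrite (ell2_norm_eq_0 x Ex), plus_zero_l, ell2_norm_zero. lra. }
  destruct (Req_dec (ell2_norm y) 0) as [Ey|Ey].
  { rewrite (ell2_norm_eq_0 y Ey), plus_zero_r, ell2_norm_zero. lra. }
  assert (Hx' : 0 < ell2_norm x) by lra. assert (Hy' : 0 < ell2_norm y) by lra.
  set (t := ell2_norm y / ell2_norm x).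
  assert (Ht : 0 < t) by now apply Rdiv_lt_0_compat.
  apply Rsqr_incr_0_var; [|lra].
  rewrite !Rsqr_pow2, ell2_norm_sqr.
  apply Rle_trans with
    (Series (fun n => (1 + t) * Cmod (x n) ^ 2 + (1 + / t) * Cmod (y n) ^ 2)).
  - apply Series_le; [|apply square_summable_lin; apply coef_summable].
    intros n. split; [apply pow2_ge_0|]. now apply Cmod_plus_sqr.
  - rewrite Series_plus.
    + rewrite !Series_scal_l, <- !ell2_norm_sqr. right. unfold t. field. lra.
    + apply (ex_series_scal (1 + t) (fun n => Cmod (x n) ^ 2)), coef_summable.
    + apply (ex_series_scal (1 + / t) (fun n => Cmod (y n) ^ 2)), coef_summable.
Qed.

Lemma ell2_norm_scal : forall (k : C) (x : ell2),
  ell2_norm (scal k x) <= Cmod k * ell2_norm x.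
Proof.
  intros k x. apply Rsqr_incr_0_var.
  - rewrite Rsqr_mult, !Rsqr_pow2, !ell2_norm_sqr, <- Series_scal_l.
    right. apply Series_ext. intros n. simpl coef. rewrite Cmod_mult. ring.
  - apply Rmult_le_pos; [apply Cmod_ge_0 | apply ell2_norm_pos].
Qed.

Definition ell2_UniformSpace_mixin : UniformSpace.mixin_of ell2 :=
  norm_uniform_mixin ell2_ModuleSpace ell2_norm ell2_norm_triangle ell2_norm_scal.
Canonical ell2_UniformSpace :=
  UniformSpace.Pack ell2 ell2_UniformSpace_mixin ell2.
Canonical ell2_NormedModuleAux :=
  NormedModuleAux.Pack C_AbsRing ell2
    (NormedModuleAux.Class C_AbsRing ell2
       (ModuleSpace.class C_Ring ell2_ModuleSpace)
       (UniformSpace.class ell2_UniformSpace)) ell2.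
Definition ell2_NormedModule_mixin :
  NormedModule.mixin_of C_AbsRing ell2_NormedModuleAux.
Proof.
  refine (NormedModule.Mixin C_AbsRing ell2_NormedModuleAux ell2_norm 1
            ell2_norm_triangle ell2_norm_scal _ _ ell2_norm_eq_0).
  - intros x y e H. exact H.
  - intros x y e H. rewrite Rmult_1_l. exact H.
Defined.
Canonical ell2_NormedModule :=
  NormedModule.Pack C_AbsRing ell2
    (NormedModule.Class C_AbsRing ell2
       (NormedModuleAux.class C_AbsRing ell2_NormedModuleAux)
       ell2_NormedModule_mixin) ell2.

(* Coquelicot's Series is real-valued, hence the two components; the product is
   linear in the first variable. *)
Definition inner (x y : ell2) : C :=
  (Series (fun k => Re (x k * Cconj (y k))%C),
   Series (fun k => Im (x k * Cconj (y k))%C)).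

Definition delta (n k : nat) : C := if Nat.eq_dec k n then RtoC 1 else RtoC 0.

Lemma square_summable_delta : forall n, square_summable (delta n).
Proof.
  intros n. apply square_summable_finite with (S n). intros k Hk.
  unfold delta. destruct (Nat.eq_dec k n); [lia | easy].
Qed.

Definition basis (n : nat) : ell2 := Ell2 (delta n) (square_summable_delta n).

Lemma Series_single : forall (a : nat -> R) (n : nat),
  (forall k, k <> n -> a k = 0) -> Series a = a n.
Proof.
  intros a n H.
  assert (Ht : forall k, a (S n + k)%nat = 0) by (intros k; apply H; lia).
  assert (Hs : ex_series a).
  { apply ex_series_finite with (S n). intros k Hk. apply H. lia. }
  rewrite (Series_incr_n a (S n)) by (auto; lia).
  rewrite (Series_zero (fun k => a (S n + k)%nat)) by exact Ht.
  simpl pred. rewrite Rplus_0_r. clear Ht Hs.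
  destruct n as [|n]; [reflexivity|]. simpl.
  rewrite (sum_eq a (fun _ => 0) n) by (intros i Hi; apply H; lia).
  rewrite sum_cte. ring.
Qed.

Lemma inner_basis : forall (x : ell2) (n : nat), inner x (basis n) = x n.
Proof.
  intros x n. unfold inner.
  rewrite (Series_single (fun k => Re (x k * Cconj (basis n k))%C) n),
          (Series_single (fun k => Im (x k * Cconj (basis n k))%C) n);
    simpl; unfold delta.
  - destruct (Nat.eq_dec n n); [|easy]. destruct (x n) as [a b].
    unfold RtoC, Cconj, Cmult, Re, Im; simpl. f_equal; ring.
  - intros k Hk. destruct (Nat.eq_dec k n); [easy|].
    unfold RtoC, Cconj, Cmult, Re, Im; simpl. ring.
  - intros k Hk. destruct (Nat.eq_dec k n); [easy|].
    unfold RtoC, Cconj, Cmult, Re, Im; simpl. ring.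
Qed.

Definition unit_ball {E : NormedModule C_AbsRing} (x : E) : Prop := norm x < 1.

(* Complex Frechet differentiability at every point of U; meaningful for open U,
   since ex_filterdiff looks at a full neighbourhood of x. *)
Definition holomorphic_on {E F : NormedModule C_AbsRing}
    (U : E -> Prop) (f : E -> F) : Prop :=
  forall x, U x -> ex_filterdiff f (locally x).

Definition bounded_on {E F : NormedModule C_AbsRing}
    (U : E -> Prop) (f : E -> F) : Prop :=
  exists M : R, forall x, U x -> norm (f x) <= M.

Definition unif_continuous_on {E F : NormedModule C_AbsRing}
    (U : E -> Prop) (f : E -> F) : Prop :=
  forall eps : R, 0 < eps -> exists delta : R, 0 < delta /\
    forall x y, U x -> U y ->
      norm (minus x y) < delta -> norm (minus (f x) (f y)) < eps.

Definition zero_off {E F : NormedModule C_AbsRing}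
    (U : E -> Prop) (f : E -> F) : Prop :=
  forall x, ~ U x -> f x = zero.

Definition ball_restr {E F : NormedModule C_AbsRing} (f : E -> F) (x : E) : F :=
  if Rlt_dec (norm x) 1 then f x else zero.

(* Coquelicot has two normed module structures on C, with the same norm. *)
Lemma filterdiff_AbsRing_C : forall (E : NormedModule C_AbsRing)
    (f l : E -> C) (G : (E -> Prop) -> Prop),
  filterdiff (V := C_NormedModule) f G l ->
  filterdiff (V := AbsRing_NormedModule C_AbsRing) f G l.
Proof.
  intros E f l G [[H1 H2 H3] H]. split; [split|].
  - exact H1.
  - exact H2.
  - exact H3.
  - exact H.
Qed.

Section HoloClosure.

Context {E F : NormedModule C_AbsRing}.

Lemma ball_restr_in : forall (f : E -> F) x, unit_ball x -> ball_restr f x = f x.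
Proof. intros f x H. unfold ball_restr. now destruct (Rlt_dec (norm x) 1). Qed.

Lemma ball_restr_off : forall f : E -> F, zero_off unit_ball (ball_restr f).
Proof. intros f x H. unfold ball_restr. now destruct (Rlt_dec (norm x) 1). Qed.

Lemma unit_ball_zero : unit_ball (zero : E).
Proof. unfold unit_ball. rewrite norm_zero. lra. Qed.

Lemma locally_unit_ball : forall x : E, unit_ball x -> locally x unit_ball.
Proof.
  intros x Hx. unfold unit_ball in *. apply locally_le_locally_norm.
  assert (He : 0 < 1 - norm x) by lra.
  exists (mkposreal _ He). intros y Hy. unfold ball_norm in Hy. simpl in Hy.
  replace y with (plus x (minus y x)).
  - eapply Rle_lt_trans; [apply norm_triangle | lra].
  - apply plus_minus_r.
Qed.

Lemma holo_ball_restr : forall f : E -> F,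
  holomorphic_on unit_ball f -> holomorphic_on unit_ball (ball_restr f).
Proof.
  intros f Hf x Hx. destruct (Hf x Hx) as [l Hl]. exists l.
  apply filterdiff_ext_locally with (2 := Hl).
  generalize (locally_unit_ball x Hx). apply filter_imp.
  intros y Hy. now rewrite ball_restr_in.
Qed.

Lemma holo_const : forall (U : E -> Prop) (a : F), holomorphic_on U (fun _ => a).
Proof. intros U a x _. exists (fun _ => zero). apply filterdiff_const. Qed.

Lemma holo_plus : forall (U : E -> Prop) (f g : E -> F),
  holomorphic_on U f -> holomorphic_on U g ->
  holomorphic_on U (fun x => plus (f x) (g x)).
Proof.
  intros U f g Hf Hg x Hx.
  destruct (Hf x Hx) as [lf Hlf]. destruct (Hg x Hx) as [lg Hlg].
  exists (fun u => plus (lf u) (lg u)). now apply filterdiff_plus_fct; try apply locally_filter.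
Qed.

Lemma holo_opp : forall (U : E -> Prop) (f : E -> F),
  holomorphic_on U f -> holomorphic_on U (fun x => opp (f x)).
Proof.
  intros U f Hf x Hx. destruct (Hf x Hx) as [l Hl].
  exists (fun u => opp (l u)). now apply filterdiff_opp_fct; try apply locally_filter.
Qed.

Lemma holo_scal : forall (U : E -> Prop) (k : C) (f : E -> F),
  holomorphic_on U f -> holomorphic_on U (fun x => scal k (f x)).
Proof.
  intros U k f Hf x Hx. destruct (Hf x Hx) as [l Hl].
  exists (fun u => scal k (l u)).
  exact (filterdiff_scal_r_fct (K := C_AbsRing) k f l Cmult_comm Hl).
Qed.

Lemma holo_mult : forall (U : E -> Prop) (f g : E -> C),
  holomorphic_on U f -> holomorphic_on U g ->
  holomorphic_on U (fun x => f x * g x)%C.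
Proof.
  intros U f g Hf Hg x Hx.
  destruct (Hf x Hx) as [lf Hlf]. destruct (Hg x Hx) as [lg Hlg].
  eexists.
  exact (filterdiff_scal_fct (K := C_AbsRing) (V := C_NormedModule)
           x f g lf lg Cmult_comm
           (filterdiff_AbsRing_C _ _ _ _ Hlf) Hlg).
Qed.

Lemma bounded_const : forall (U : E -> Prop) (a : F), bounded_on U (fun _ => a).
Proof. intros U a. exists (norm a). intros; lra. Qed.

Lemma bounded_plus : forall (U : E -> Prop) (f g : E -> F),
  bounded_on U f -> bounded_on U g -> bounded_on U (fun x => plus (f x) (g x)).
Proof.
  intros U f g [M HM] [N HN]. exists (M + N). intros x Hx.
  eapply Rle_trans; [apply norm_triangle|]. now apply Rplus_le_compat; auto.
Qed.

Lemma bounded_opp : forall (U : E -> Prop) (f : E -> F),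
  bounded_on U f -> bounded_on U (fun x => opp (f x)).
Proof. intros U f [M HM]. exists M. intros x Hx. rewrite norm_opp. auto. Qed.

Lemma bounded_scal : forall (U : E -> Prop) (k : C) (f : E -> F),
  bounded_on U f -> bounded_on U (fun x => scal k (f x)).
Proof.
  intros U k f [M HM]. exists (Cmod k * M). intros x Hx.
  eapply Rle_trans; [apply (norm_scal (K := C_AbsRing))|].
  apply Rmult_le_compat_l; [apply Cmod_ge_0 | auto].
Qed.

Lemma bounded_mult : forall (U : E -> Prop) (f g : E -> C),
  bounded_on U f -> bounded_on U g -> bounded_on U (fun x => f x * g x)%C.
Proof.
  intros U f g [M HM] [N HN]. exists (M * N). intros x Hx.
  change (Cmod (f x * g x) <= M * N). rewrite Cmod_mult.
  apply Rmult_le_compat; try apply Cmod_ge_0; [now apply HM | now apply HN].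
Qed.

Lemma bounded_ball_restr : forall f : E -> F,
  bounded_on unit_ball f -> bounded_on unit_ball (ball_restr f).
Proof.
  intros f [M HM]. exists M. intros x Hx. rewrite ball_restr_in; auto.
Qed.

Lemma uc_const : forall (U : E -> Prop) (a : F), unif_continuous_on U (fun _ => a).
Proof.
  intros U a eps He. exists 1. split; [lra|]. intros.
  rewrite minus_eq_zero. eapply Rle_lt_trans; [right; apply norm_zero | exact He].
Qed.

Lemma uc_plus : forall (U : E -> Prop) (f g : E -> F),
  unif_continuous_on U f -> unif_continuous_on U g ->
  unif_continuous_on U (fun x => plus (f x) (g x)).
Proof.
  intros U f g Hf Hg eps He.
  destruct (Hf (eps / 2)) as [d1 [Hd1 H1]]; [lra|].
  destruct (Hg (eps / 2)) as [d2 [Hd2 H2]]; [lra|].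
  exists (Rmin d1 d2). split; [now apply Rmin_pos|]. intros x y Hx Hy Hxy.
  replace (minus (plus (f x) (g x)) (plus (f y) (g y)))
    with (plus (minus (f x) (f y)) (minus (g x) (g y))).
  - assert (A := H1 x y Hx Hy (Rlt_le_trans _ _ _ Hxy (Rmin_l _ _))).
    assert (B := H2 x y Hx Hy (Rlt_le_trans _ _ _ Hxy (Rmin_r _ _))).
    eapply Rle_lt_trans; [apply norm_triangle | lra].
  - apply minus_plus_plus.
Qed.

Lemma uc_opp : forall (U : E -> Prop) (f : E -> F),
  unif_continuous_on U f -> unif_continuous_on U (fun x => opp (f x)).
Proof.
  intros U f Hf eps He. destruct (Hf eps He) as [d [Hd H]].
  exists d. split; [easy|]. intros x y Hx Hy Hxy.
  replace (minus (opp (f x)) (opp (f y))) with (opp (minus (f x) (f y))).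
  - rewrite norm_opp. now apply H.
  - apply opp_plus.
Qed.

Lemma uc_scal : forall (U : E -> Prop) (k : C) (f : E -> F),
  unif_continuous_on U f -> unif_continuous_on U (fun x => scal k (f x)).
Proof.
  intros U k f Hf eps He. assert (Hk := Cmod_ge_0 k).
  destruct (Hf (eps / (Cmod k + 1))) as [d [Hd H]].
  { apply Rdiv_lt_0_compat; lra. }
  exists d. split; [easy|]. intros x y Hx Hy Hxy.
  specialize (H x y Hx Hy Hxy).
  assert (Eq : minus (scal k (f x)) (scal k (f y)) = scal k (minus (f x) (f y))).
  { symmetry. exact (scal_minus F k (f x) (f y)). }
  eapply Rle_lt_trans; [right; exact (f_equal norm Eq)|].
  eapply Rle_lt_trans; [apply (norm_scal (K := C_AbsRing))|].
  change (Cmod k * norm (minus (f x) (f y)) < eps).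
  apply Rle_lt_trans with (Cmod k * (eps / (Cmod k + 1))).
  - apply Rmult_le_compat_l; lra.
  - apply Rmult_lt_reg_r with (Cmod k + 1); [lra|].
    replace (Cmod k * (eps / (Cmod k + 1)) * (Cmod k + 1)) with (Cmod k * eps)
      by (field; lra).
    nra.
Qed.

Lemma uc_mult : forall (U : E -> Prop) (f g : E -> C),
  bounded_on U f -> bounded_on U g ->
  unif_continuous_on U f -> unif_continuous_on U g ->
  unif_continuous_on U (fun x => f x * g x)%C.
Proof.
  intros U f g [M HM] [N HN] Hf Hg eps He.
  set (K := Rabs M + Rabs N + 1).
  assert (HKM := Rle_abs M). assert (HKN := Rle_abs N).
  assert (A := Rabs_pos M). assert (B := Rabs_pos N).
  assert (HK : 0 < K) by (unfold K; lra).
  destruct (Hf (eps / (2 * K))) as [d1 [Hd1 H1]].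
  { apply Rdiv_lt_0_compat; lra. }
  destruct (Hg (eps / (2 * K))) as [d2 [Hd2 H2]].
  { apply Rdiv_lt_0_compat; lra. }
  exists (Rmin d1 d2). split; [now apply Rmin_pos|]. intros x y Hx Hy Hxy.
  specialize (H1 x y Hx Hy (Rlt_le_trans _ _ _ Hxy (Rmin_l _ _))).
  specialize (H2 x y Hx Hy (Rlt_le_trans _ _ _ Hxy (Rmin_r _ _))).
  change (Cmod (f x - f y) < eps / (2 * K)) in H1.
  change (Cmod (g x - g y) < eps / (2 * K)) in H2.
  change (Cmod (f x * g x - f y * g y) < eps).
  replace (f x * g x - f y * g y)%C
    with (f x * (g x - g y) + (f x - f y) * g y)%C by ring.
  eapply Rle_lt_trans; [apply Cmod_triangle|]. rewrite !Cmod_mult.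
  assert (P : Cmod (f x) <= K).
  { apply Rle_trans with M; [now apply HM | unfold K; lra]. }
  assert (Q : Cmod (g y) <= K).
  { apply Rle_trans with N; [now apply HN | unfold K; lra]. }
  assert (R1 : Cmod (f x) * Cmod (g x - g y) <= K * Cmod (g x - g y)).
  { apply Rmult_le_compat_r; [apply Cmod_ge_0 | easy]. }
  assert (R2 : Cmod (f x - f y) * Cmod (g y) <= Cmod (f x - f y) * K).
  { apply Rmult_le_compat_l; [apply Cmod_ge_0 | easy]. }
  assert (R3 : K * Cmod (g x - g y) < eps / 2).
  { replace (eps / 2) with (K * (eps / (2 * K))) by (field; lra).
    now apply Rmult_lt_compat_l. }
  assert (R4 : K * Cmod (f x - f y) < eps / 2).
  { replace (eps / 2) with (K * (eps / (2 * K))) by (field; lra).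
    now apply Rmult_lt_compat_l. }
  lra.
Qed.

Lemma uc_ball_restr : forall f : E -> F,
  unif_continuous_on unit_ball f -> unif_continuous_on unit_ball (ball_restr f).
Proof.
  intros f Hf eps He. destruct (Hf eps He) as [d [Hd H]].
  exists d. split; [easy|]. intros x y Hx Hy Hxy.
  rewrite !ball_restr_in by easy. now apply H.
Qed.

Lemma zero_off_plus : forall (U : E -> Prop) (f g : E -> F),
  zero_off U f -> zero_off U g -> zero_off U (fun x => plus (f x) (g x)).
Proof. intros U f g Hf Hg x Hx. rewrite Hf, Hg by easy. apply plus_zero_l. Qed.

Lemma zero_off_opp : forall (U : E -> Prop) (f : E -> F),
  zero_off U f -> zero_off U (fun x => opp (f x)).
Proof. intros U f Hf x Hx. rewrite Hf by easy. exact (opp_zero (G := F)). Qed.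

Lemma zero_off_scal : forall (U : E -> Prop) (k : C) (f : E -> F),
  zero_off U f -> zero_off U (fun x => scal k (f x)).
Proof.
  intros U k f Hf x Hx. rewrite Hf by easy. exact (scal_zero_r (K := C_Ring) (V := F) k).
Qed.

Lemma zero_off_mult : forall (U : E -> Prop) (f g : E -> C),
  zero_off U f -> zero_off U g -> zero_off U (fun x => f x * g x)%C.
Proof. intros U f g Hf Hg x Hx. rewrite Hf by easy. apply Cmult_0_l. Qed.

Lemma norm_RtoC_scal : forall (r : R) (x : E), 0 <= r ->
  norm (scal (RtoC r) x) <= r * norm x.
Proof.
  intros r x Hr. eapply Rle_trans; [apply (norm_scal (K := C_AbsRing))|].
  change (abs (RtoC r)) with (Cmod (RtoC r)).
  rewrite Cmod_R, Rabs_pos_eq; lra.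
Qed.

Lemma uc_bounded : forall f : E -> F,
  unif_continuous_on unit_ball f -> bounded_on unit_ball f.
Proof.
  intros f Hf. destruct (Hf 1) as [d [Hd H]]; [lra|].
  destruct (archimed_cor1 d Hd) as [N [HN1 HN2]].
  assert (HNp : 0 < INR N) by now apply lt_0_INR.
  exists (norm (f zero) + INR N). intros x Hx.
  set (p := fun k : nat => scal (RtoC (INR k / INR N)) x).
  assert (Hp : forall k, (k <= N)%nat -> unit_ball (p k)).
  { intros k Hk. apply Rle_lt_trans with (INR k / INR N * norm x).
    - apply norm_RtoC_scal.
      apply Rmult_le_pos; [apply pos_INR | left; now apply Rinv_0_lt_compat].
    - assert (INR k / INR N <= 1).
      { apply Rmult_le_reg_r with (INR N); [easy|].
        replace (INR k / INR N * INR N) with (INR k) by (field; lra).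
        rewrite Rmult_1_l. now apply le_INR. }
      unfold unit_ball in Hx. assert (0 <= norm x) by apply norm_ge_0. nra. }
  assert (Hb : forall k, (k <= N)%nat -> norm (f (p k)) <= norm (f zero) + INR k).
  { induction k as [|k IH]; intros Hk.
    - replace (p 0%nat) with (zero : E); [simpl; lra|].
      unfold p. simpl. unfold Rdiv. rewrite Rmult_0_l. symmetry.
      exact (scal_zero_l (K := C_Ring) (V := E) x).
    - replace (f (p (S k))) with (plus (f (p k)) (minus (f (p (S k))) (f (p k)))).
      + eapply Rle_trans; [apply norm_triangle|].
        assert (norm (minus (f (p (S k))) (f (p k))) < 1).
        { apply H; [now apply Hp | apply Hp; lia |].
          assert (Eq : scal (RtoC (/ INR N)) x = minus (p (S k)) (p k)).
          { unfold p, minus.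
            set (a := RtoC (INR (S k) / INR N)). set (b := RtoC (INR k / INR N)).
            replace (RtoC (/ INR N)) with (a - b)%C.
            + eapply eq_trans;
                [exact (scal_distr_r (K := C_Ring) (V := E) a (- b)%C x)|].
              apply f_equal. exact (scal_opp_l (K := C_Ring) (V := E) b x).
            + unfold a, b. rewrite <- RtoC_minus. f_equal. rewrite S_INR. field. lra. }
          eapply Rle_lt_trans; [right; exact (f_equal norm (eq_sym Eq))|].
          eapply Rle_lt_trans;
            [apply norm_RtoC_scal; left; now apply Rinv_0_lt_compat|].
          assert (0 < / INR N) by now apply Rinv_0_lt_compat.
          assert (0 <= norm x) by apply norm_ge_0.
          unfold unit_ball in Hx. nra. }
        specialize (IH ltac:(lia)). rewrite S_INR. lra.
      + apply plus_minus_r. }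
  replace x with (p N).
  - now apply Hb.
  - unfold p. replace (INR N / INR N) with 1 by (field; lra).
    exact (scal_one (K := C_Ring) (V := E) x).
Qed.

End HoloClosure.

(* H^oo of the unit ball of l2, with values in F.  A map on the ball is
   represented by its extension by zero, so that Leibniz equality is equality
   on the ball. *)

Record Hinf (F : NormedModule C_AbsRing) : Type := MkHinf {
  Hinf_fun :> ell2 -> F;
  Hinf_holo : holomorphic_on unit_ball Hinf_fun;
  Hinf_bounded : bounded_on unit_ball Hinf_fun;
  Hinf_off : zero_off unit_ball Hinf_fun }.

Arguments MkHinf {F}.
Arguments Hinf_fun {F}.
Arguments Hinf_holo {F}.
Arguments Hinf_bounded {F}.
Arguments Hinf_off {F}.

Section Hinf.

Context {F : NormedModule C_AbsRing}.

Lemma Hinf_ext : forall f g : Hinf F, (forall x, f x = g x) -> f = g.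
Proof.
  intros [f Hf1 Hf2 Hf3] [g Hg1 Hg2 Hg3] H; simpl in H.
  assert (E : f = g) by (apply functional_extensionality; exact H).
  subst g. f_equal; apply proof_irrelevance.
Qed.

Definition Hinf_zero : Hinf F :=
  MkHinf (fun _ => zero) (holo_const _ zero) (bounded_const _ zero) (fun _ _ => eq_refl).
Definition Hinf_plus (f g : Hinf F) : Hinf F :=
  MkHinf (fun x => plus (f x) (g x))
    (holo_plus _ f g (Hinf_holo f) (Hinf_holo g))
    (bounded_plus _ f g (Hinf_bounded f) (Hinf_bounded g))
    (zero_off_plus _ f g (Hinf_off f) (Hinf_off g)).
Definition Hinf_opp (f : Hinf F) : Hinf F :=
  MkHinf (fun x => opp (f x)) (holo_opp _ f (Hinf_holo f))
    (bounded_opp _ f (Hinf_bounded f)) (zero_off_opp _ f (Hinf_off f)).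
Definition Hinf_scal (k : C) (f : Hinf F) : Hinf F :=
  MkHinf (fun x => scal k (f x)) (holo_scal _ k f (Hinf_holo f))
    (bounded_scal _ k f (Hinf_bounded f)) (zero_off_scal _ k f (Hinf_off f)).

Definition Hinf_AbelianMonoid_mixin : AbelianMonoid.mixin_of (Hinf F).
Proof.
  refine (AbelianMonoid.Mixin (Hinf F) Hinf_plus Hinf_zero _ _ _);
    intros; apply Hinf_ext; intros t; simpl.
  - apply plus_comm.
  - apply plus_assoc.
  - apply plus_zero_r.
Defined.
Canonical Hinf_AbelianMonoid :=
  AbelianMonoid.Pack (Hinf F) Hinf_AbelianMonoid_mixin (Hinf F).

Definition Hinf_AbelianGroup_mixin : AbelianGroup.mixin_of Hinf_AbelianMonoid.
Proof.
  refine (AbelianGroup.Mixin Hinf_AbelianMonoid Hinf_opp _);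
    intros f; apply Hinf_ext; intros t; exact (plus_opp_r (G := F) (f t)).
Defined.
Canonical Hinf_AbelianGroup :=
  AbelianGroup.Pack (Hinf F)
    (AbelianGroup.Class (Hinf F) Hinf_AbelianMonoid_mixin Hinf_AbelianGroup_mixin)
    (Hinf F).

Definition Hinf_ModuleSpace_mixin : ModuleSpace.mixin_of C_Ring Hinf_AbelianGroup.
Proof.
  refine (ModuleSpace.Mixin C_Ring Hinf_AbelianGroup Hinf_scal _ _ _ _);
    intros; apply Hinf_ext; intros t.
  - apply (scal_assoc (K := C_Ring) (V := F)).
  - apply (scal_one (K := C_Ring) (V := F)).
  - apply (scal_distr_l (K := C_Ring) (V := F)).
  - apply (scal_distr_r (K := C_Ring) (V := F)).
Defined.
Canonical Hinf_ModuleSpace :=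
  ModuleSpace.Pack C_Ring (Hinf F)
    (ModuleSpace.Class C_Ring (Hinf F) (AbelianGroup.class Hinf_AbelianGroup)
       Hinf_ModuleSpace_mixin) (Hinf F).

Definition Hinf_norm (f : Hinf F) : R :=
  real (Lub_Rbar (fun r => exists x, unit_ball x /\ r = norm (f x))).

Lemma Hinf_norm_lub : forall f : Hinf F,
  is_lub_Rbar (fun r => exists x, unit_ball x /\ r = norm (f x)) (Finite (Hinf_norm f)).
Proof.
  intros f. unfold Hinf_norm.
  assert (H := Lub_Rbar_correct (fun r => exists x, unit_ball x /\ r = norm (f x))).
  destruct (Lub_Rbar (fun r => exists x, unit_ball x /\ r = norm (f x))) as [r| |];
    [exact H | exfalso | exfalso].
  - destruct (Hinf_bounded f) as [M HM].
    apply (proj2 H (Finite M)). intros r [x [Hx ->]]. now apply HM.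
  - apply (proj1 H (norm (f zero))). exists zero. split; [apply unit_ball_zero | easy].
Qed.

Lemma Hinf_norm_ub : forall (f : Hinf F) x, unit_ball x -> norm (f x) <= Hinf_norm f.
Proof. intros f x Hx. apply (proj1 (Hinf_norm_lub f)). now exists x. Qed.

Lemma Hinf_norm_le : forall (f : Hinf F) (M : R),
  (forall x, unit_ball x -> norm (f x) <= M) -> Hinf_norm f <= M.
Proof.
  intros f M H. apply (proj2 (Hinf_norm_lub f) (Finite M)).
  intros r [x [Hx ->]]. now apply H.
Qed.

Lemma Hinf_norm_triangle : forall f g : Hinf F,
  Hinf_norm (plus f g) <= Hinf_norm f + Hinf_norm g.
Proof.
  intros f g. apply Hinf_norm_le. intros x Hx. simpl.
  eapply Rle_trans; [apply norm_triangle|].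
  now apply Rplus_le_compat; apply Hinf_norm_ub.
Qed.

Lemma Hinf_norm_scal : forall (k : C) (f : Hinf F),
  Hinf_norm (scal k f) <= Cmod k * Hinf_norm f.
Proof.
  intros k f. apply Hinf_norm_le. intros x Hx. simpl.
  eapply Rle_trans; [apply (norm_scal (K := C_AbsRing))|].
  apply Rmult_le_compat_l; [apply Cmod_ge_0 | now apply Hinf_norm_ub].
Qed.

Lemma Hinf_norm_eq_0 : forall f : Hinf F, Hinf_norm f = 0 -> f = zero.
Proof.
  intros f H. apply Hinf_ext. intros x.
  destruct (Rlt_dec (norm x) 1) as [Hx|Hx].
  - apply norm_eq_zero. apply Rle_antisym; [|apply norm_ge_0].
    rewrite <- H. now apply Hinf_norm_ub.
  - now apply Hinf_off.
Qed.

Definition Hinf_UniformSpace_mixin : UniformSpace.mixin_of (Hinf F) :=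
  norm_uniform_mixin Hinf_ModuleSpace Hinf_norm Hinf_norm_triangle Hinf_norm_scal.
Canonical Hinf_UniformSpace :=
  UniformSpace.Pack (Hinf F) Hinf_UniformSpace_mixin (Hinf F).
Canonical Hinf_NormedModuleAux :=
  NormedModuleAux.Pack C_AbsRing (Hinf F)
    (NormedModuleAux.Class C_AbsRing (Hinf F)
       (ModuleSpace.class C_Ring Hinf_ModuleSpace)
       (UniformSpace.class Hinf_UniformSpace)) (Hinf F).
Definition Hinf_NormedModule_mixin :
  NormedModule.mixin_of C_AbsRing Hinf_NormedModuleAux.
Proof.
  refine (NormedModule.Mixin C_AbsRing Hinf_NormedModuleAux Hinf_norm 1
            Hinf_norm_triangle Hinf_norm_scal _ _ Hinf_norm_eq_0).
  - intros x y e H. exact H.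
  - intros x y e H. rewrite Rmult_1_l. exact H.
Defined.
Canonical Hinf_NormedModule :=
  NormedModule.Pack C_AbsRing (Hinf F)
    (NormedModule.Class C_AbsRing (Hinf F)
       (NormedModuleAux.class C_AbsRing Hinf_NormedModuleAux)
       Hinf_NormedModule_mixin) (Hinf F).

End Hinf.

Notation HinfC := (Hinf C_NormedModule).
Notation Hinf_ell2 := (Hinf ell2_NormedModule).

Definition HinfC_one : HinfC :=
  MkHinf (F := C_NormedModule) (ball_restr (fun _ => RtoC 1))
    (holo_ball_restr _ (holo_const _ _)) (bounded_ball_restr _ (bounded_const _ _))
    (ball_restr_off _).
Definition HinfC_mult (f g : HinfC) : HinfC :=
  MkHinf (F := C_NormedModule) (fun x => f x * g x)%C
    (holo_mult _ f g (Hinf_holo f) (Hinf_holo g))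
    (bounded_mult _ f g (Hinf_bounded f) (Hinf_bounded g))
    (zero_off_mult _ f g (Hinf_off f) (Hinf_off g)).

Lemma HinfC_mult_one_r : forall f : HinfC, HinfC_mult f HinfC_one = f.
Proof.
  intros f. apply Hinf_ext. intros x. simpl. unfold ball_restr.
  destruct (Rlt_dec (norm x) 1) as [Hx|Hx].
  - apply Cmult_1_r.
  - rewrite (Hinf_off f x Hx). apply Cmult_0_l.
Qed.

Definition HinfC_Ring_mixin : Ring.mixin_of (@Hinf_AbelianGroup C_NormedModule).
Proof.
  refine (Ring.Mixin (@Hinf_AbelianGroup C_NormedModule)
            HinfC_mult HinfC_one _ HinfC_mult_one_r _ _ _).
  - intros f g h. apply Hinf_ext. intros x. apply Cmult_assoc.
  - intros f. transitivity (HinfC_mult f HinfC_one); [|apply HinfC_mult_one_r].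
    apply Hinf_ext. intros x. apply Cmult_comm.
  - intros f g h. apply Hinf_ext. intros x. apply Cmult_plus_distr_r.
  - intros f g h. apply Hinf_ext. intros x. apply Cmult_plus_distr_l.
Defined.
Canonical HinfC_Ring :=
  Ring.Pack HinfC
    (Ring.Class HinfC (AbelianGroup.class (@Hinf_AbelianGroup C_NormedModule))
       HinfC_Ring_mixin) HinfC.

(* The algebra A_u; its members are again extended by zero, and boundedness on
   the ball follows from uniform continuity (uc_bounded). *)

Record Au : Type := MkAu {
  Au_fun :> ell2 -> C;
  Au_holo : holomorphic_on unit_ball Au_fun;
  Au_uc : unif_continuous_on unit_ball Au_fun;
  Au_off : zero_off unit_ball Au_fun }.

Lemma Au_ext : forall f g : Au, (forall x, f x = g x) -> f = g.
Proof.
  intros [f Hf1 Hf2 Hf3] [g Hg1 Hg2 Hg3] H; simpl in H.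
  assert (E : f = g) by (apply functional_extensionality; exact H).
  subst g. f_equal; apply proof_irrelevance.
Qed.

Definition Au_zero : Au :=
  MkAu (fun _ => RtoC 0) (holo_const _ _) (uc_const _ _) (fun _ _ => eq_refl).
Definition Au_plus (f g : Au) : Au :=
  MkAu (fun x => f x + g x)%C
    (holo_plus _ f g (Au_holo f) (Au_holo g))
    (uc_plus _ f g (Au_uc f) (Au_uc g))
    (zero_off_plus _ f g (Au_off f) (Au_off g)).
Definition Au_opp (f : Au) : Au :=
  MkAu (fun x => - f x)%C (holo_opp _ f (Au_holo f))
    (uc_opp _ f (Au_uc f)) (zero_off_opp _ f (Au_off f)).
Definition Au_scal (k : C) (f : Au) : Au :=
  MkAu (fun x => k * f x)%C (holo_scal _ k f (Au_holo f))
    (uc_scal _ k f (Au_uc f)) (zero_off_scal _ k f (Au_off f)).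
Definition Au_one : Au :=
  MkAu (ball_restr (fun _ => RtoC 1)) (holo_ball_restr _ (holo_const _ _))
    (uc_ball_restr _ (uc_const _ _)) (ball_restr_off _).
Definition Au_mult (f g : Au) : Au :=
  MkAu (fun x => f x * g x)%C
    (holo_mult _ f g (Au_holo f) (Au_holo g))
    (uc_mult _ f g (uc_bounded f (Au_uc f)) (uc_bounded g (Au_uc g))
       (Au_uc f) (Au_uc g))
    (zero_off_mult _ f g (Au_off f) (Au_off g)).

Definition Au_AbelianMonoid_mixin : AbelianMonoid.mixin_of Au.
Proof.
  refine (AbelianMonoid.Mixin Au Au_plus Au_zero _ _ _);
    intros; apply Au_ext; intros t; simpl; ring.
Defined.
Canonical Au_AbelianMonoid := AbelianMonoid.Pack Au Au_AbelianMonoid_mixin Au.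

Definition Au_AbelianGroup_mixin : AbelianGroup.mixin_of Au_AbelianMonoid.
Proof.
  refine (AbelianGroup.Mixin Au_AbelianMonoid Au_opp _);
    intros; apply Au_ext; intros t; simpl; ring.
Defined.
Canonical Au_AbelianGroup :=
  AbelianGroup.Pack Au
    (AbelianGroup.Class Au Au_AbelianMonoid_mixin Au_AbelianGroup_mixin) Au.

Lemma Au_mult_one_r : forall f : Au, Au_mult f Au_one = f.
Proof.
  intros f. apply Au_ext. intros x. simpl. unfold ball_restr.
  destruct (Rlt_dec (norm x) 1) as [Hx|Hx].
  - apply Cmult_1_r.
  - rewrite (Au_off f x Hx). apply Cmult_0_l.
Qed.

Definition Au_Ring_mixin : Ring.mixin_of Au_AbelianGroup.
Proof.
  refine (Ring.Mixin Au_AbelianGroup Au_mult Au_one _ Au_mult_one_r _ _ _).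
  - intros f g h. apply Au_ext. intros x. apply Cmult_assoc.
  - intros f. transitivity (Au_mult f Au_one); [|apply Au_mult_one_r].
    apply Au_ext. intros x. apply Cmult_comm.
  - intros f g h. apply Au_ext. intros x. apply Cmult_plus_distr_r.
  - intros f g h. apply Au_ext. intros x. apply Cmult_plus_distr_l.
Defined.
Canonical Au_Ring :=
  Ring.Pack Au (Ring.Class Au (AbelianGroup.class Au_AbelianGroup) Au_Ring_mixin) Au.

Definition Au_ModuleSpace_mixin : ModuleSpace.mixin_of C_Ring Au_AbelianGroup.
Proof.
  refine (ModuleSpace.Mixin C_Ring Au_AbelianGroup Au_scal _ _ _ _);
    intros; apply Au_ext; intros t; simpl; unfold mult, plus, one; simpl; ring.
Defined.
Canonical Au_ModuleSpace :=
  ModuleSpace.Pack C_Ring Au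
    (ModuleSpace.Class C_Ring Au (AbelianGroup.class Au_AbelianGroup)
       Au_ModuleSpace_mixin) Au.

Lemma is_linear_coord : forall n,
  is_linear (U := ell2_NormedModule) (V := C_NormedModule) (fun x => inner x (basis n)).
Proof.
  intros n. split.
  - intros x y. now rewrite !inner_basis.
  - intros k x. now rewrite !inner_basis.
  - exists 1. split; [lra|]. intros x. rewrite inner_basis, Rmult_1_l.
    apply ell2_coef_le.
Qed.

Lemma holo_coord : forall n,
  holomorphic_on (E := ell2_NormedModule) (F := C_NormedModule) unit_ball
    (fun x => inner x (basis n)).
Proof.
  intros n x _. exists (fun x => inner x (basis n)).
  apply filterdiff_linear, is_linear_coord.
Qed.

Lemma uc_coord : forall n,
  unif_continuous_on (E := ell2_NormedModule) (F := C_NormedModule) unit_ball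
    (fun x => inner x (basis n)).
Proof.
  intros n eps He. exists eps. split; [easy|]. intros x y _ _ H.
  rewrite !inner_basis. eapply Rle_lt_trans; [|exact H].
  exact (ell2_coef_le (minus x y) n).
Qed.

Definition coord (n : nat) : Au :=
  MkAu (ball_restr (fun x => inner x (basis n)))
    (holo_ball_restr _ (holo_coord n)) (uc_ball_restr _ (uc_coord n))
    (ball_restr_off _).

Definition algebra_hom (Phi : Au -> HinfC) : Prop :=
  (forall f g, Phi (plus f g) = plus (Phi f) (Phi g)) /\
  (forall (k : C) f, Phi (scal k f) = scal k (Phi f)) /\
  (forall f g, Phi (mult f g) = mult (Phi f) (Phi g)).

Record spectrum : Type := Spectrum {
  spectrum_fun :> Au -> HinfC;
  spectrum_hom : algebra_hom spectrum_fun;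
  spectrum_nonzero : exists f, spectrum_fun f <> zero }.

(* The sequence of values of Phi on the coordinate functions at x always lies in
   l2 (and has norm at most 1), but no proof of this is needed to compare it
   with the l2-valued g in the definition of the fiber. *)
Definition xi (Phi : spectrum) (x : ell2) : nat -> C := fun n => Phi (coord n) x.

Definition fiber (g : Hinf_ell2) (Phi : spectrum) : Prop :=
  forall x, unit_ball x -> forall n, xi Phi x n = g x n.

Definition analytic_on_ball (Psi : Hinf_ell2 -> spectrum) : Prop :=
  forall (f : Au) (x : ell2), unit_ball x ->
    holomorphic_on (F := C_NormedModule) unit_ball (fun h : Hinf_ell2 => Psi h f x).

(* Main.v *)
Require Import Defs.
From Stdlib Require Import Reals Lra Lia Psatz Arith.
From Stdlib Require Import Classical ClassicalEpsilon FunctionalExtensionality.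
From mathcomp Require filter.
From Coquelicot Require Import Coquelicot.
Open Scope R_scope.

(** Let [c = (1 - |g|) / 3] and, for [y] in l2, let [v_n(y)] be [c] times the sum
    of the basis vector of index [n^2] and of the first [n] coordinates of [y]
    moved to the indices [n^2 + 1, ..., n^2 + n].  For [|h| < 1] the points
    [g x + v_n (h x)] stay in the ball, and the homomorphism attached to [h] is
    [f |-> (x |-> lim_U f (g x + v_n (h x)))] for a free ultrafilter [U].  Each
    coordinate of [v_n] is eventually zero, so this lies in the fiber over [g].
    The quadratic functional [f_j z = sum_(i > j) z_(i^2) z_(i^2 + 1 + j)] meets
    the [n]-th block in a single term, and the limit of its values is
    [f_j (g x) + c^2 (h x)_j], which recovers [h].

    Holomorphy in [x] and in [h], and that of [f_j] itself, all follow from one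
    fact: a U-limit of uniformly bounded holomorphic functions is holomorphic,
    because their second-order Taylor remainders are uniformly bounded.  As
    holomorphy only means differentiability at every point, this rests on a
    Goursat argument; carried out on polar rectangles, it makes the circle means
    of [(phi z - phi 0) / z] independent of the radius, whence Cauchy's estimate
    for [phi' 0]. *)

(** * Goursat's theorem on polar rectangles *)

Lemma nested_segments : forall a b : nat -> R,
  (forall n, a n <= a (S n)) -> (forall n, b (S n) <= b n) ->
  (forall n, a n <= b n) -> exists x, forall n, a n <= x <= b n.
Proof.
  intros a b Ha Hb Hab.
  assert (Ha' : forall n k, a n <= a (n + k)%nat).
  { intros n k. induction k as [|k IH]; [rewrite Nat.add_0_r; lra|].
    rewrite Nat.add_succ_r. specialize (Ha (n + k)%nat). lra. }
  assert (Hb' : forall n k, b (n + k)%nat <= b n).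
  { intros n k. induction k as [|k IH]; [rewrite Nat.add_0_r; lra|].
    rewrite Nat.add_succ_r. specialize (Hb (n + k)%nat). lra. }
  assert (Hub : forall n, is_upper_bound (fun r => exists k, r = a k) (b n)).
  { intros n r [k ->]. specialize (Ha' k n). specialize (Hb' n k).
    specialize (Hab (k + n)%nat). rewrite (Nat.add_comm n k) in Hb'. lra. }
  destruct (completeness (fun r => exists k, r = a k)) as [x [Hx1 Hx2]].
  - exists (b 0%nat). apply Hub.
  - now exists (a 0%nat), 0%nat.
  - exists x. intros n. split; [apply Hx1; now exists n | apply Hx2, Hub].
Qed.

Lemma halving_small : forall L d : R, 0 < d -> exists N, forall n, (N <= n)%nat -> L / 2 ^ n < d.
Proof.
  intros L d Hd.
  destruct (Pow_x_infinity 2 ltac:(rewrite Rabs_pos_eq; lra) ((Rabs L + 1) / d)) as [N HN].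
  exists N. intros n Hn. specialize (HN n Hn).
  assert (Hp : 0 < 2 ^ n) by (apply pow_lt; lra).
  rewrite Rabs_pos_eq in HN by lra.
  apply Rmult_lt_reg_r with (2 ^ n); [easy|].
  replace (L / 2 ^ n * 2 ^ n) with L by (field; lra).
  assert (HL := Rle_abs L). apply Rge_le in HN.
  apply (Rmult_le_compat_r d) in HN; [|lra].
  replace ((Rabs L + 1) / d * d) with (Rabs L + 1) in HN by (field; lra). lra.
Qed.

(* An additive rectangle function that is small at second order around every
   point vanishes: bisect and look at the point where the pieces shrink. *)
Section Bisection.

Variables (J : R -> R -> R -> R -> R) (a b c d : R).
Hypothesis Hab : a < b.
Hypothesis Hcd : c < d.
Hypothesis J_split_l : forall x m y s t,
  a <= x <= m -> m <= y <= b -> c <= s <= t -> t <= d ->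
  J x y s t = J x m s t + J m y s t.
Hypothesis J_split_r : forall x y s m t,
  a <= x <= y -> y <= b -> c <= s <= m -> m <= t <= d ->
  J x y s t = J x y s m + J x y m t.
Hypothesis J_local : forall p q, a <= p <= b -> c <= q <= d ->
  forall eps, 0 < eps -> exists delta, 0 < delta /\
  forall x y s t, a <= x <= p -> p <= y <= b -> c <= s <= q -> q <= t <= d ->
    y - x < delta -> t - s < delta ->
    Rabs (J x y s t) <= eps * ((y - x) + (t - s)) ^ 2.

Let w n := (b - a) / 2 ^ n.
Let h n := (d - c) / 2 ^ n.

(** The threshold is quadratic in the side lengths, so halving both sides divides it by exactly 4.
    This is what lets an excess over it pass to one of four quarters. *)
Definition too_big (eps : R) (n : nat) (p : R * R) : Prop :=
  eps * (w n + h n) ^ 2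
    < Rabs (J (fst p) (fst p + w n) (snd p) (snd p + h n)).

Definition too_big_dec eps n p : {too_big eps n p} + {~ too_big eps n p} :=
  Rlt_dec _ _.

(** The last quarter is taken without a test: when the rectangle itself is too big and the first
    three quarters are not, additivity forces the fourth to be. *)
Definition bisect_step (eps : R) (n : nat) (p : R * R) : R * R :=
  let (x, s) := p in
  if too_big_dec eps (S n) (x, s) then (x, s)
  else if too_big_dec eps (S n) (x + w (S n), s) then (x + w (S n), s)
  else if too_big_dec eps (S n) (x, s + h (S n)) then (x, s + h (S n))
  else (x + w (S n), s + h (S n)).

Fixpoint bisect (eps : R) (n : nat) : R * R :=
  match n with
  | O => (a, c)
  | S n => bisect_step eps n (bisect eps n)
  end.

Lemma half_w : forall n, w n = 2 * w (S n).
Proof. intros n. unfold w. simpl. field. apply pow_nonzero. lra. Qed.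

Lemma half_h : forall n, h n = 2 * h (S n).
Proof. intros n. unfold h. simpl. field. apply pow_nonzero. lra. Qed.

Lemma w_pos : forall n, 0 < w n.
Proof. intros n. apply Rdiv_lt_0_compat; [lra | apply pow_lt; lra]. Qed.

Lemma h_pos : forall n, 0 < h n.
Proof. intros n. apply Rdiv_lt_0_compat; [lra | apply pow_lt; lra]. Qed.

(** If all four quarters respected the quarter threshold, the triangle inequality would bound the
    whole by four times it, which is the threshold one level up. *)
Lemma bisect_step_too_big : forall eps n p,
  a <= fst p -> fst p + w n <= b -> c <= snd p -> snd p + h n <= d ->
  too_big eps n p -> too_big eps (S n) (bisect_step eps n p).
Proof.
  intros eps n [x s] H1 H2 H3 H4 H. simpl in H1, H2, H3, H4.
  assert (Hw := w_pos (S n)). assert (Hh := h_pos (S n)).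
  assert (Ew := half_w n). assert (Eh := half_h n).
  unfold bisect_step.
  destruct (too_big_dec eps (S n) (x, s)) as [B1|B1]; [exact B1|].
  destruct (too_big_dec eps (S n) (x + w (S n), s)) as [B2|B2]; [exact B2|].
  destruct (too_big_dec eps (S n) (x, s + h (S n))) as [B3|B3]; [exact B3|].
  unfold too_big in *. simpl fst in *. simpl snd in *.
  rewrite Ew, Eh in H. rewrite Ew in H2. rewrite Eh in H4.
  rewrite (J_split_l x (x + w (S n))) in H by lra.
  rewrite (J_split_r x _ s (s + h (S n))) in H by lra.
  rewrite (J_split_r (x + w (S n)) _ s (s + h (S n))) in H by lra.
  replace (x + 2 * w (S n)) with (x + w (S n) + w (S n)) in H by ring.
  replace (s + 2 * h (S n)) with (s + h (S n) + h (S n)) in H by ring.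
  apply Rnot_lt_le in B1, B2, B3. apply Rnot_le_lt. intros B4.
  revert H. apply Rle_not_lt.
  eapply Rle_trans; [apply Rabs_triang|].
  eapply Rle_trans; [apply Rplus_le_compat; apply Rabs_triang|].
  replace (eps * (2 * w (S n) + 2 * h (S n)) ^ 2)
    with (4 * (eps * (w (S n) + h (S n)) ^ 2)) by ring.
  lra.
Qed.

Lemma bisect_step_range : forall eps n p,
  fst p <= fst (bisect_step eps n p) /\
  fst (bisect_step eps n p) + w (S n) <= fst p + w n /\
  snd p <= snd (bisect_step eps n p) /\
  snd (bisect_step eps n p) + h (S n) <= snd p + h n.
Proof.
  intros eps n [x s].
  assert (Hw := w_pos (S n)). assert (Hh := h_pos (S n)).
  rewrite (half_w n), (half_h n). unfold bisect_step.
  destruct (too_big_dec eps (S n) (x, s)) as [B1|B1]; [simpl; lra|].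
  destruct (too_big_dec eps (S n) (x + w (S n), s)) as [B2|B2]; [simpl; lra|].
  destruct (too_big_dec eps (S n) (x, s + h (S n))) as [B3|B3]; simpl; lra.
Qed.

Lemma rectangle_function_zero : J a b c d = 0.
Proof.
  assert (Key : forall eps, 0 < eps -> Rabs (J a b c d) <= eps * ((b - a) + (d - c)) ^ 2).
  { intros eps Heps. apply Rnot_lt_le. intros Hbig.
    assert (Hw0 : w 0 = b - a) by (unfold w; simpl; field).
    assert (Hh0 : h 0 = d - c) by (unfold h; simpl; field).
    set (x := fun n => fst (bisect eps n)). set (s := fun n => snd (bisect eps n)).
    assert (Hr := fun n => bisect_step_range eps n (bisect eps n)).
    assert (Hin : forall n, a <= x n /\ x n + w n <= b /\ c <= s n /\ s n + h n <= d).
    { induction n as [|n IH].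
      - unfold x, s. simpl. rewrite Hw0, Hh0. lra.
      - specialize (Hr n). unfold x, s in *. simpl. lra. }
    assert (HB : forall n, too_big eps n (bisect eps n)).
    { induction n as [|n IH].
      - unfold too_big. simpl. rewrite Hw0, Hh0.
        now replace (a + (b - a)) with b by ring; replace (c + (d - c)) with d by ring.
      - simpl. apply bisect_step_too_big; try apply (Hin n). exact IH. }
    (* The point [(p, q)] common to all chosen rectangles may lie on their sides, which is why
       [J_local] is stated with closed inequalities. *)
    destruct (nested_segments x (fun n => x n + w n)) as [p Hp].
    { intros n. apply (Hr n). } { intros n. apply (Hr n). }
    { intros n. assert (H := w_pos n). lra. }
    destruct (nested_segments s (fun n => s n + h n)) as [q Hq].
    { intros n. apply (Hr n). } { intros n. apply (Hr n). }
    { intros n. assert (H := h_pos n). lra. }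
    destruct (J_local p q) with (eps := eps) as [delta [Hd HJ]]; auto.
    { specialize (Hin 0%nat). specialize (Hp 0%nat). lra. }
    { specialize (Hin 0%nat). specialize (Hq 0%nat). lra. }
    destruct (halving_small (b - a) delta Hd) as [N1 HN1].
    destruct (halving_small (d - c) delta Hd) as [N2 HN2].
    set (n := (N1 + N2)%nat). specialize (HN1 n ltac:(lia)). specialize (HN2 n ltac:(lia)).
    fold (w n) in HN1. fold (h n) in HN2.
    specialize (Hp n). specialize (Hq n). specialize (Hin n). specialize (HB n).
    revert HB. apply Rle_not_lt. fold (x n) (s n).
    specialize (HJ (x n) (x n + w n) (s n) (s n + h n)).
    replace (x n + w n - x n) with (w n) in HJ by ring.
    replace (s n + h n - s n) with (h n) in HJ by ring.
    apply HJ; lra. }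
  destruct (Req_dec (J a b c d) 0) as [H0|H0]; [easy|exfalso].
  assert (HJ := Rabs_pos_lt _ H0).
  set (K := ((b - a) + (d - c)) ^ 2) in *.
  assert (HK : 0 < K) by (apply pow_lt; lra).
  (* With this [eps] the bound reads |J| <= |J| / 2, impossible for a nonzero value. *)
  specialize (Key (Rabs (J a b c d) / (2 * K)) ltac:(apply Rdiv_lt_0_compat; lra)).
  replace (Rabs (J a b c d) / (2 * K) * K) with (Rabs (J a b c d) / 2) in Key by (field; lra).
  lra.
Qed.

End Bisection.

(** Written as a remainder bound instead of a quotient, so [w = z] needs no exception and a Frechet
    remainder on a complex line has the same shape. *)
Definition cderiv (f : C -> C) (z l : C) : Prop :=
  forall eps, 0 < eps -> exists delta, 0 < delta /\ forall w, Cmod (w - z) < delta ->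
    Cmod (f w - f z - l * (w - z)) <= eps * Cmod (w - z).

Lemma im_le_Cmod : forall z : C, Rabs (Im z) <= Cmod z.
Proof.
  intros z. eapply Rle_trans; [apply Rmax_r | apply Rmax_Cmod].
Qed.

Lemma Cmod_le_re_im : forall z : C, Cmod z <= Rabs (Re z) + Rabs (Im z).
Proof.
  intros [x y]. replace (x, y) with (RtoC x + Ci * RtoC y)%C.
  - eapply Rle_trans; [apply Cmod_triangle|].
    rewrite Cmod_mult, Cmod_Ci, !Cmod_R.
    unfold RtoC, Ci, Cplus, Cmult, Re, Im; simpl.
    replace (x + (0 * y - 1 * 0)) with x by ring.
    replace (0 + (0 * 0 + 1 * y)) with y by ring. lra.
  - unfold RtoC, Ci, Cplus, Cmult; simpl. f_equal; ring.
Qed.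

Lemma cderiv_lipschitz_at : forall f z l, cderiv f z l -> exists delta, 0 < delta /\
  forall w, Cmod (w - z) < delta -> Cmod (f w - f z) <= (Cmod l + 1) * Cmod (w - z).
Proof.
  intros f z l H. destruct (H 1) as [d [Hd H1]]; [lra|].
  exists d. split; [easy|]. intros w Hw. specialize (H1 w Hw).
  replace (f w - f z)%C with (l * (w - z) + (f w - f z - l * (w - z)))%C by ring.
  eapply Rle_trans; [apply Cmod_triangle|]. rewrite Cmod_mult. lra.
Qed.

(** Here [p] stands for [Re] or [Im], since all integrals below are real. Differentiability at the
    single point [gam t0] gives a local Lipschitz bound, which the bound on [gam] carries to the
    parameter. *)
Lemma continuous_along : forall (p : C -> R) (f : C -> C) (gam : R -> C) (t0 K : R) l,
  (forall z w, Rabs (p z - p w) <= Cmod (z - w)) ->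
  cderiv f (gam t0) l -> (forall t, Cmod (gam t - gam t0) <= K * Rabs (t - t0)) ->
  continuous (fun t => p (f (gam t))) t0.
Proof.
  intros p f gam t0 K l Hp Hf Hg.
  destruct (cderiv_lipschitz_at _ _ _ Hf) as [d [Hd H]].
  assert (Hl := Cmod_ge_0 l). assert (HK := Rabs_pos K). assert (HK' := Rle_abs K).
  apply filterlim_locally. intros eps.
  set (M := (Cmod l + 1) * (Rabs K + 1)).
  assert (HM : 0 < M) by (apply Rmult_lt_0_compat; lra).
  assert (Hpos : 0 < Rmin (d / (Rabs K + 1)) (eps / M)).
  { apply Rmin_pos; apply Rdiv_lt_0_compat; try lra. apply cond_pos. }
  exists (mkposreal _ Hpos). intros t Ht.
  change (Rabs (t - t0) < Rmin (d / (Rabs K + 1)) (eps / M)) in Ht.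
  change (Rabs (p (f (gam t)) - p (f (gam t0))) < eps).
  assert (H1 := Rlt_le_trans _ _ _ Ht (Rmin_l _ _)).
  assert (H2 := Rlt_le_trans _ _ _ Ht (Rmin_r _ _)).
  apply Rmult_lt_compat_r with (r := Rabs K + 1) in H1; [|lra].
  apply Rmult_lt_compat_r with (r := M) in H2; [|lra].
  replace (d / (Rabs K + 1) * (Rabs K + 1)) with d in H1 by (field; lra).
  replace (eps / M * M) with (pos eps) in H2 by (field; lra).
  assert (Hg' : Cmod (gam t - gam t0) <= (Rabs K + 1) * Rabs (t - t0)).
  { eapply Rle_trans; [apply Hg|]. apply Rmult_le_compat_r; [apply Rabs_pos | lra]. }
  eapply Rle_lt_trans; [apply Hp|].
  eapply Rle_lt_trans; [apply H; lra|].
  eapply Rle_lt_trans; [apply Rmult_le_compat_l; [lra | apply Hg']|].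
  unfold M in H2. lra.
Qed.

Lemma Re_lipschitz : forall z w : C, Rabs (Re z - Re w) <= Cmod (z - w).
Proof. intros z w. exact (re_le_Cmod (z - w)). Qed.

Lemma Im_lipschitz : forall z w : C, Rabs (Im z - Im w) <= Cmod (z - w).
Proof. intros z w. exact (im_le_Cmod (z - w)). Qed.

(** * Polar coordinates and boundary integrals of polar rectangles *)

Definition polar (r t : R) : C := (r * cos t, r * sin t).

Lemma Cmod_polar : forall r t, 0 <= r -> Cmod (polar r t) = r.
Proof.
  intros r t Hr. unfold Cmod, polar. simpl fst. simpl snd.
  replace ((r * cos t) ^ 2 + (r * sin t) ^ 2) with (r ^ 2 * (Rsqr (sin t) + Rsqr (cos t)))
    by (unfold Rsqr; ring).
  rewrite sin2_cos2, Rmult_1_r. now apply sqrt_pow2.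
Qed.

Lemma cos_lipschitz : forall s t, Rabs (cos t - cos s) <= Rabs (t - s).
Proof.
  intros s t. rewrite <- (Rmult_1_l (Rabs (t - s))).
  apply (bounded_variation cos (fun u => - sin u)). intros u _. split.
  - auto_derive; [easy | ring].
  - rewrite Rabs_Ropp. apply Rabs_le. apply SIN_bound.
Qed.

Lemma sin_lipschitz : forall s t, Rabs (sin t - sin s) <= Rabs (t - s).
Proof.
  intros s t. rewrite <- (Rmult_1_l (Rabs (t - s))).
  apply (bounded_variation sin cos). intros u _. split.
  - auto_derive; [easy | ring].
  - apply Rabs_le. apply COS_bound.
Qed.

Lemma polar_lipschitz : forall r t r0 t0, 0 <= r0 ->
  Cmod (polar r t - polar r0 t0) <= 2 * Rabs (r - r0) + 2 * r0 * Rabs (t - t0).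
Proof.
  intros r t r0 t0 Hr. eapply Rle_trans; [apply Cmod_le_re_im|].
  unfold polar, Cminus, Cplus, Copp, Re, Im; simpl.
  assert (Hc := cos_lipschitz t0 t). assert (Hs := sin_lipschitz t0 t).
  replace (r * cos t + - (r0 * cos t0))
    with ((r - r0) * cos t + r0 * (cos t - cos t0)) by ring.
  replace (r * sin t + - (r0 * sin t0))
    with ((r - r0) * sin t + r0 * (sin t - sin t0)) by ring.
  assert (B1 : Rabs (cos t) <= 1) by (apply Rabs_le, COS_bound).
  assert (B2 : Rabs (sin t) <= 1) by (apply Rabs_le, SIN_bound).
  assert (H0 := Rabs_pos (r - r0)).
  assert (T1 := Rabs_triang ((r - r0) * cos t) (r0 * (cos t - cos t0))).
  assert (T2 := Rabs_triang ((r - r0) * sin t) (r0 * (sin t - sin t0))).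
  rewrite !Rabs_mult, (Rabs_pos_eq r0) in T1, T2 by easy.
  assert (r0 * Rabs (cos t - cos t0) <= r0 * Rabs (t - t0)) by now apply Rmult_le_compat_l.
  assert (r0 * Rabs (sin t - sin t0) <= r0 * Rabs (t - t0)) by now apply Rmult_le_compat_l.
  assert (Rabs (r - r0) * Rabs (cos t) <= Rabs (r - r0) * 1) by now apply Rmult_le_compat_l.
  assert (Rabs (r - r0) * Rabs (sin t) <= Rabs (r - r0) * 1) by now apply Rmult_le_compat_l.
  lra.
Qed.

(* Minus the real part of the integral of F(z) dz/z along the boundary of the polar
   rectangle [a <= r <= b], [s <= angle <= t]; only real integrals are involved. *)
Definition polar_boundary (F : C -> C) (a b s t : R) : R :=
  RInt (fun u => Im (F (polar b u)) - Im (F (polar a u))) s t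
  + RInt (fun r => (Re (F (polar r t)) - Re (F (polar r s))) / r) a b.

Lemma ex_RInt_cont : forall (f : R -> R) a b, a <= b ->
  (forall x, a <= x <= b -> continuous f x) -> ex_RInt f a b.
Proof.
  intros f a b Hab H. apply (ex_RInt_continuous (V := R_CompleteNormedModule)).
  intros x. rewrite Rmin_left, Rmax_right by easy. apply H.
Qed.

Lemma RInt_close : forall (f g : R -> R) a b M, a <= b ->
  ex_RInt f a b -> ex_RInt g a b ->
  (forall x, a <= x <= b -> Rabs (f x - g x) <= M) ->
  Rabs (RInt f a b - RInt g a b) <= (b - a) * M.
Proof.
  intros f g a b M Hab Hf Hg H.
  replace (RInt f a b - RInt g a b) with (RInt (fun x => f x - g x) a b).
  - apply abs_RInt_le_const; auto. now apply (ex_RInt_minus (V := R_NormedModule)).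
  - now apply (RInt_minus (V := R_CompleteNormedModule)).
Qed.

Section PolarGoursat.

Variables (F : C -> C) (rho : R).
Hypothesis F_deriv : forall z, 0 < Cmod z < rho -> exists l, cderiv F z l.

Lemma polar_continuous_t : forall (p : C -> R) r t,
  (forall z w, Rabs (p z - p w) <= Cmod (z - w)) -> 0 < r < rho ->
  continuous (fun u => p (F (polar r u))) t.
Proof.
  intros p r t Hp Hr. destruct (F_deriv (polar r t)) as [l Hl].
  { rewrite Cmod_polar; lra. }
  apply continuous_along with (2 * r) l; auto. intros u.
  eapply Rle_trans; [apply polar_lipschitz; lra|].
  rewrite Rminus_diag, Rabs_R0. lra.
Qed.

Lemma polar_continuous_r : forall (p : C -> R) r t,
  (forall z w, Rabs (p z - p w) <= Cmod (z - w)) -> 0 < r < rho ->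
  continuous (fun u => p (F (polar u t))) r.
Proof.
  intros p r t Hp Hr. destruct (F_deriv (polar r t)) as [l Hl].
  { rewrite Cmod_polar; lra. }
  apply (continuous_along p F (fun u => polar u t) r 2 l); auto. intros u.
  eapply Rle_trans; [apply polar_lipschitz; lra|].
  rewrite Rminus_diag, Rabs_R0. lra.
Qed.

Lemma polar_arc_integrable : forall r s t, 0 < r < rho -> s <= t ->
  ex_RInt (fun u => Im (F (polar r u))) s t.
Proof.
  intros r s t Hr Hst. apply ex_RInt_cont; auto. intros u _.
  apply (polar_continuous_t Im); auto. apply Im_lipschitz.
Qed.

Lemma polar_arcs_integrable : forall x y s t, 0 < x < rho -> 0 < y < rho -> s <= t ->
  ex_RInt (fun u => Im (F (polar y u)) - Im (F (polar x u))) s t.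
Proof.
  intros x y s t Hx Hy Hst.
  apply (ex_RInt_minus (V := R_NormedModule)); now apply polar_arc_integrable.
Qed.

Lemma polar_rays_integrable : forall x y s t, 0 < x -> x <= y -> y < rho ->
  ex_RInt (fun r => (Re (F (polar r t)) - Re (F (polar r s))) / r) x y.
Proof.
  intros x y s t Hx Hxy Hy. apply ex_RInt_cont; auto. intros r Hr.
  apply (continuous_mult (K := R_AbsRing)
           (fun r => Re (F (polar r t)) - Re (F (polar r s))) Rinv).
  - apply (continuous_minus (V := R_NormedModule) (fun r => Re (F (polar r t)))
             (fun r => Re (F (polar r s))));
      apply (polar_continuous_r Re); try apply Re_lipschitz; lra.
  - apply continuous_Rinv. lra.
Qed.

End PolarGoursat.

Definition affine (al be z : C) : C := (al + be * z)%C.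

Lemma cderiv_affine : forall al be z, cderiv (affine al be) z be.
Proof.
  intros al be z eps He. exists 1. split; [lra|]. intros w _. unfold affine.
  replace (al + be * w - (al + be * z) - be * (w - z))%C with (RtoC 0) by ring.
  rewrite Cmod_0. apply Rmult_le_pos; [lra | apply Cmod_ge_0].
Qed.

(** The constant [al] cancels in every difference. For the linear part the ray integrand does not
    depend on the radius, and the arc integrand has an elementary primitive whose increment is the
    opposite of the ray contribution. *)
Lemma polar_boundary_affine : forall al be x y s t, 0 < x -> x <= y ->
  polar_boundary (affine al be) x y s t = 0.
Proof.
  intros [a1 a2] [b1 b2] x y s t Hx Hxy. unfold polar_boundary.
  rewrite (RInt_ext _ (fun u => (y - x) * (b1 * sin u + b2 * cos u)))
    by (intros u _; unfold affine, polar, Cplus, Cmult, Im; simpl; ring).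
  rewrite (RInt_ext (fun r => (Re (affine (a1, a2) (b1, b2) (polar r t))
                     - Re (affine (a1, a2) (b1, b2) (polar r s))) / r)
             (fun _ => b1 * (cos t - cos s) - b2 * (sin t - sin s))).
  - rewrite RInt_const.
    rewrite (is_RInt_unique _ s t (minus ((y - x) * (b2 * sin t - b1 * cos t))
                                         ((y - x) * (b2 * sin s - b1 * cos s)))).
    + unfold minus, plus, opp, scal; simpl; unfold mult; simpl. ring.
    + apply (is_RInt_derive (V := R_CompleteNormedModule)
               (fun u => (y - x) * (b2 * sin u - b1 * cos u))).
      * intros u _. auto_derive; [easy | ring].
      * intros u _. apply (ex_derive_continuous (V := R_NormedModule)).
        auto_derive. easy.
  - intros r Hr. rewrite Rmin_left in Hr by easy.
    unfold affine, polar, Cplus, Cmult, Re; simpl. field. lra.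
Qed.

(** Each integrand is a difference of two values of the function, hence the factor 2; on the rays
    the weight [1 / r] is at most [1 / x]. *)
Lemma polar_boundary_close : forall F G rho x y s t M,
  (forall z, 0 < Cmod z < rho -> exists l, cderiv F z l) ->
  (forall z, 0 < Cmod z < rho -> exists l, cderiv G z l) ->
  0 < x -> x <= y -> y < rho -> s <= t ->
  (forall r u, x <= r <= y -> s <= u <= t -> Cmod (F (polar r u) - G (polar r u)) <= M) ->
  Rabs (polar_boundary F x y s t - polar_boundary G x y s t)
    <= (t - s) * (2 * M) + (y - x) * (2 * M / x).
Proof.
  intros F G rho x y s t M HF HG Hx Hxy Hy Hst H.
  assert (HM : 0 <= M).
  { eapply Rle_trans; [apply Cmod_ge_0 | apply (H x s); lra]. }
  unfold polar_boundary.
  match goal with |- Rabs (?p + ?q - (?p' + ?q')) <= _ =>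
    replace (p + q - (p' + q')) with ((p - p') + (q - q')) by ring end.
  eapply Rle_trans; [apply Rabs_triang|].
  assert (HR : forall r u, x <= r <= y -> s <= u <= t ->
    Rabs (Re (F (polar r u)) - Re (G (polar r u))) <= M).
  { intros r u Hr Hu. eapply Rle_trans; [apply Re_lipschitz | now apply H]. }
  assert (HI : forall r u, x <= r <= y -> s <= u <= t ->
    Rabs (Im (F (polar r u)) - Im (G (polar r u))) <= M).
  { intros r u Hr Hu. eapply Rle_trans; [apply Im_lipschitz | now apply H]. }
  apply Rplus_le_compat; apply RInt_close; auto.
  - apply polar_arcs_integrable with rho; auto; lra.
  - apply polar_arcs_integrable with rho; auto; lra.
  - intros u Hu. assert (A := HI x u ltac:(lra) Hu). assert (B := HI y u ltac:(lra) Hu).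
    apply Rabs_le_between in A, B. apply Rabs_le_between. lra.
  - apply polar_rays_integrable with rho; auto.
  - apply polar_rays_integrable with rho; auto.
  - intros r Hr. assert (A := HR r s Hr ltac:(lra)). assert (B := HR r t Hr ltac:(lra)).
    match goal with |- Rabs (?u / r - ?v / r) <= _ =>
      replace (u / r - v / r) with ((u - v) * / r) by (field; lra) end.
    rewrite Rabs_mult.
    rewrite (Rabs_pos_eq (/ r)) by (left; apply Rinv_0_lt_compat; lra).
    apply Rmult_le_compat; [apply Rabs_pos | left; apply Rinv_0_lt_compat; lra | | ].
    + apply Rabs_le_between in A, B. apply Rabs_le_between. lra.
    + apply Rinv_le_contravar; lra.
Qed.

(** Additivity holds because the common side of adjacent rectangles cancels. Near a point [F]
    differs from its first-order affine part by a small multiple of the diameter; integrating this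
    over the sides gives a second-order quantity, and the affine part contributes nothing. *)
Lemma polar_goursat : forall F rho a b c d,
  (forall z, 0 < Cmod z < rho -> exists l, cderiv F z l) ->
  0 < a -> a < b -> b < rho -> c < d -> polar_boundary F a b c d = 0.
Proof.
  intros F rho a b c d HF Ha Hab Hb Hcd.
  apply rectangle_function_zero; auto.
  - intros x m y s t Hx Hy Hs Ht. unfold polar_boundary.
    rewrite <- (RInt_Chasles (V := R_CompleteNormedModule) _ x m y)
      by (apply polar_rays_integrable with rho; auto; lra).
    rewrite (RInt_ext (fun u => Im (F (polar y u)) - Im (F (polar x u)))
      (fun u => plus (Im (F (polar m u)) - Im (F (polar x u)))
                     (Im (F (polar y u)) - Im (F (polar m u)))))
      by (intros u _; unfold plus; simpl; ring).
    rewrite (RInt_plus (V := R_CompleteNormedModule))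
      by (apply polar_arcs_integrable with rho; auto; lra).
    unfold plus; simpl. ring.
  - intros x y s m t Hx Hy Hs Ht. unfold polar_boundary.
    rewrite <- (RInt_Chasles (V := R_CompleteNormedModule) _ s m t)
      by (apply polar_arcs_integrable with rho; auto; lra).
    rewrite (RInt_ext (fun r => (Re (F (polar r t)) - Re (F (polar r s))) / r)
      (fun r => plus ((Re (F (polar r m)) - Re (F (polar r s))) / r)
                     ((Re (F (polar r t)) - Re (F (polar r m))) / r)))
      by (intros u _; unfold plus; simpl; unfold Rdiv; ring).
    rewrite (RInt_plus (V := R_CompleteNormedModule))
      by (apply polar_rays_integrable with rho; auto; lra).
    unfold plus; simpl. ring.
  - intros p q Hp Hq eps He.
    set (z0 := polar p q).
    destruct (HF z0) as [l Hl].
    { unfold z0. rewrite Cmod_polar; lra. }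
    (* [K] bounds the distance from [z0] in the plane by [K] times the half-perimeter [L] in polar
       coordinates, for radii up to [b]. *)
    set (K := 2 + 2 * b). assert (HK : 0 < K) by (unfold K; lra).
    assert (Hia : 0 < / a) by now apply Rinv_0_lt_compat.
    (* The final bound is 2 e K L^2 (1 + 1/a), and this choice makes it equal to eps L^2. *)
    set (e := eps / (2 * K * (1 + / a))).
    assert (He' : 0 < e).
    { apply Rdiv_lt_0_compat; [easy|]. apply Rmult_lt_0_compat; lra. }
    destruct (Hl e He') as [dl [Hdl Hdl']].
    exists (dl / (2 * K)). split; [apply Rdiv_lt_0_compat; lra|].
    intros x y s t Hx Hy Hs Ht Hyx Hts.
    set (L := y - x + (t - s)).
    assert (HLd : K * L < dl).
    { apply Rlt_le_trans with (K * (dl / (2 * K) + dl / (2 * K))).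
      - apply Rmult_lt_compat_l; unfold L; lra.
      - right. field. lra. }
    (* Subtracting the vanishing boundary integral of the first-order part leaves only the remainder
       of [F] to be integrated. *)
    assert (H0 := polar_boundary_affine (F z0 - l * z0) l x y s t ltac:(lra) ltac:(lra)).
    rewrite <- (Rminus_0_r (polar_boundary F x y s t)), <- H0.
    eapply Rle_trans.
    + apply (polar_boundary_close F _ rho x y s t (e * (K * L))); auto; try lra.
      * intros z _. eexists. apply cderiv_affine.
      * intros r u Hr Hu.
        assert (Hz : Cmod (polar r u - z0) <= K * L).
        { unfold z0. eapply Rle_trans; [apply polar_lipschitz; lra|].
          assert (Rabs (r - p) <= L) by (apply Rabs_le; unfold L; lra).
          assert (Rabs (u - q) <= L) by (apply Rabs_le; unfold L; lra).
          assert (p * Rabs (u - q) <= b * L).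
          { apply Rmult_le_compat; try lra. apply Rabs_pos. }
          unfold K. lra. }
        unfold affine.
        replace (F (polar r u) - (F z0 - l * z0 + l * polar r u))%C
          with (F (polar r u) - F z0 - l * (polar r u - z0))%C by ring.
        eapply Rle_trans; [apply Hdl'; lra|].
        apply Rmult_le_compat_l; lra.
    + assert (HL : 0 <= L) by (unfold L; lra).
      assert (HP : 0 <= 2 * (e * (K * L))) 
        by (apply Rmult_le_pos; [lra|]; apply Rmult_le_pos; [lra|]; apply Rmult_le_pos; lra).
      apply Rle_trans with (L * (2 * (e * (K * L))) + L * (2 * (e * (K * L)) / a)).
      * apply Rplus_le_compat; apply Rmult_le_compat; try exact HP; try apply Rle_refl; try (unfold L; lra).
        -- apply Rmult_le_pos; [easy|]. left. apply Rinv_0_lt_compat. lra.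
        -- apply Rmult_le_compat_l; [easy|]. apply Rinv_le_contravar; lra.
      * right. unfold e. field. split; [|split]; lra.
Qed.

(** Over a full turn the two rays of the polar rectangle coincide and cancel, leaving the two
    circles. Only the punctured disc is involved, so [F] may be a difference quotient at the
    origin. *)
Lemma circle_integral_const : forall F rho a b,
  (forall z, 0 < Cmod z < rho -> exists l, cderiv F z l) ->
  0 < a -> a < b -> b < rho ->
  RInt (fun u => Im (F (polar b u))) 0 (2 * PI) = RInt (fun u => Im (F (polar a u))) 0 (2 * PI).
Proof.
  intros F rho a b HF Ha Hab Hb. assert (HPI := PI_RGT_0).
  assert (H := polar_goursat F rho a b 0 (2 * PI) HF Ha Hab Hb ltac:(lra)).
  unfold polar_boundary in H.
  rewrite (RInt_ext (fun r => _ / r) (fun _ => 0)) in H.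
  - rewrite RInt_const in H.
    rewrite (RInt_minus (V := R_CompleteNormedModule)
       (fun u => Im (F (polar b u))) (fun u => Im (F (polar a u)))) in H
      by (apply polar_arc_integrable with rho; auto; lra).
    unfold scal, minus, plus, opp in H; simpl in H. unfold mult in H; simpl in H. lra.
  - intros r _. unfold polar. rewrite cos_2PI, sin_2PI, cos_0, sin_0.
    unfold Rminus. rewrite Rplus_opp_r. exact (Rmult_0_l (/ r)).
Qed.

(** * Cauchy and Taylor estimates *)

Lemma cderiv_const : forall c z, cderiv (fun _ => c) z (RtoC 0).
Proof.
  intros c z eps He. exists 1. split; [lra|]. intros w _.
  replace (c - c - RtoC 0 * (w - z))%C with (RtoC 0) by ring.
  rewrite Cmod_0. apply Rmult_le_pos; [lra | apply Cmod_ge_0].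
Qed.

Lemma cderiv_minus : forall f g z l m, cderiv f z l -> cderiv g z m ->
  cderiv (fun w => f w - g w)%C z (l - m)%C.
Proof.
  intros f g z l m Hf Hg eps He.
  destruct (Hf (eps / 2)) as [d1 [Hd1 H1]]; [lra|].
  destruct (Hg (eps / 2)) as [d2 [Hd2 H2]]; [lra|].
  exists (Rmin d1 d2). split; [now apply Rmin_pos|]. intros w Hw.
  specialize (H1 w (Rlt_le_trans _ _ _ Hw (Rmin_l _ _))).
  specialize (H2 w (Rlt_le_trans _ _ _ Hw (Rmin_r _ _))).
  replace (f w - g w - (f z - g z) - (l - m) * (w - z))%C
    with ((f w - f z - l * (w - z)) + - (g w - g z - m * (w - z)))%C by ring.
  eapply Rle_trans; [apply Cmod_triangle|]. rewrite Cmod_opp. lra.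
Qed.

Lemma cderiv_mult : forall f g z l m, cderiv f z l -> cderiv g z m ->
  cderiv (fun w => f w * g w)%C z (l * g z + f z * m)%C.
Proof.
  intros f g z l m Hf Hg eps He.
  destruct (cderiv_lipschitz_at _ _ _ Hf) as [d1 [Hd1 H1]].
  destruct (cderiv_lipschitz_at _ _ _ Hg) as [d2 [Hd2 H2]].
  assert (Pf := Cmod_ge_0 (f z)). assert (Pg := Cmod_ge_0 (g z)).
  assert (Pl := Cmod_ge_0 l). assert (Pm := Cmod_ge_0 m).
  destruct (Hf (eps / (3 * (Cmod (g z) + 1)))) as [d3 [Hd3 H3]].
  { apply Rdiv_lt_0_compat; lra. }
  destruct (Hg (eps / (3 * (Cmod (f z) + 1)))) as [d4 [Hd4 H4]].
  { apply Rdiv_lt_0_compat; lra. }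
  set (Q := (Cmod l + 1) * (Cmod m + 1)).
  assert (HQ : 0 < Q) by (apply Rmult_lt_0_compat; lra).
  exists (Rmin (Rmin d1 d2) (Rmin (Rmin d3 d4) (eps / (3 * Q)))). split.
  { repeat apply Rmin_pos; auto. apply Rdiv_lt_0_compat; lra. }
  intros w Hw. apply Rmin_Rgt in Hw. destruct Hw as [Ha Hb].
  apply Rmin_Rgt in Ha, Hb. destruct Ha as [Ha1 Ha2]. destruct Hb as [Hb Hb3].
  apply Rmin_Rgt in Hb. destruct Hb as [Hb1 Hb2].
  specialize (H1 w Ha1). specialize (H2 w Ha2). specialize (H3 w Hb1). specialize (H4 w Hb2).
  replace (f w * g w - f z * g z - (l * g z + f z * m) * (w - z))%C
    with ((f w - f z - l * (w - z)) * g z + f z * (g w - g z - m * (w - z))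
          + (f w - f z) * (g w - g z))%C by ring.
  eapply Rle_trans; [apply Cmod_triangle|].
  eapply Rle_trans; [apply Rplus_le_compat_r, Cmod_triangle|].
  rewrite !Cmod_mult.
  set (t := Cmod (w - z)) in *. assert (Ht : 0 <= t) by apply Cmod_ge_0.
  assert (A1 : Cmod (f w - f z - l * (w - z)) * Cmod (g z) <= eps / 3 * t).
  { eapply Rle_trans; [apply Rmult_le_compat_r; [easy | exact H3]|].
    replace (eps / 3 * t) with (eps / (3 * (Cmod (g z) + 1)) * t * (Cmod (g z) + 1)) by (field; lra).
    apply Rmult_le_compat_l; [|lra]. apply Rmult_le_pos; [|easy].
    left. apply Rdiv_lt_0_compat; lra. }
  assert (A2 : Cmod (f z) * Cmod (g w - g z - m * (w - z)) <= eps / 3 * t).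
  { eapply Rle_trans; [apply Rmult_le_compat_l; [easy | exact H4]|].
    replace (eps / 3 * t) with ((Cmod (f z) + 1) * (eps / (3 * (Cmod (f z) + 1)) * t)) by (field; lra).
    apply Rmult_le_compat_r; [|lra]. apply Rmult_le_pos; [|easy].
    left. apply Rdiv_lt_0_compat; lra. }
  assert (A3 : Cmod (f w - f z) * Cmod (g w - g z) <= eps / 3 * t).
  { apply Rle_trans with ((Cmod l + 1) * t * ((Cmod m + 1) * t)).
    - apply Rmult_le_compat; try apply Cmod_ge_0; easy.
    - replace ((Cmod l + 1) * t * ((Cmod m + 1) * t)) with (Q * t * t) by (unfold Q; ring).
      apply Rmult_le_compat_r; [easy|].
      replace (eps / 3) with (Q * (eps / (3 * Q))) by (field; lra).
      apply Rmult_le_compat_l; lra. }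
  lra.
Qed.

Lemma cderiv_inv : forall z, z <> RtoC 0 -> cderiv Cinv z (- / (z * z))%C.
Proof.
  intros z Hz eps He. assert (Pz := proj1 (Cmod_gt_0 z) Hz).
  set (r := Cmod z) in *.
  (* The remainder is exactly (w - z)^2 / (w z^2). Once |w| >= r / 2, it is at most [eps * |w - z|]
     as soon as |w - z| is below this product. *)
  assert (Pr : 0 < eps * (r / 2) * r * r) by (repeat apply Rmult_lt_0_compat; lra).
  exists (Rmin (r / 2) (eps * (r / 2) * r * r)). split; [apply Rmin_pos; lra|].
  intros w Hw. apply Rmin_Rgt in Hw. destruct Hw as [H1 H2].
  assert (Hw : r / 2 <= Cmod w).
  { assert (H := Cmod_triangle w (z - w)). replace (w + (z - w))%C with z in H by ring.
    replace (z - w)%C with (- (w - z))%C in H by ring. rewrite Cmod_opp in H.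
    fold r in H. lra. }
  assert (Hw0 : w <> RtoC 0) by (apply Cmod_gt_0; lra).
  replace (/ w - / z - - / (z * z) * (w - z))%C with ((w - z) * (w - z) / (w * (z * z)))%C
    by (field; now split).
  rewrite Cmod_div by (repeat apply Cmult_neq_0; auto).
  rewrite !Cmod_mult. fold r. set (t := Cmod (w - z)) in *.
  assert (Ht : 0 <= t) by apply Cmod_ge_0.
  assert (Hrr : 0 < Cmod w * (r * r)) by (repeat apply Rmult_lt_0_compat; lra).
  apply Rmult_le_reg_r with (Cmod w * (r * r)); [easy|].
  replace (t * t / (Cmod w * (r * r)) * (Cmod w * (r * r))) with (t * t) by (field; lra).
  replace (eps * t * (Cmod w * (r * r))) with (eps * Cmod w * r * r * t) by ring.
  apply Rmult_le_compat_r; [easy|].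
  apply Rle_trans with (eps * (r / 2) * r * r); [lra|].
  do 2 (apply Rmult_le_compat_r; [lra|]). apply Rmult_le_compat_l; lra.
Qed.

Lemma cderiv_shift : forall f a z l, cderiv f (z + a) l -> cderiv (fun w => f (w + a)%C) z l.
Proof.
  intros f a z l H eps He. destruct (H eps He) as [d [Hd Hf]].
  exists d. split; [easy|]. intros w Hw.
  specialize (Hf (w + a)%C). replace (w + a - (z + a))%C with (w - z)%C in Hf by ring. auto.
Qed.

Lemma cderiv_scal : forall k f z l, cderiv f z l -> cderiv (fun w => k * f w)%C z (k * l)%C.
Proof.
  intros k f z l H. replace (k * l)%C with (RtoC 0 * f z + k * l)%C by ring.
  apply (cderiv_mult (fun _ => k)); [apply cderiv_const | easy].
Qed.

(** The circle means of the imaginary part of (phi z - phi 0) / z do not depend on the radius. On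
    small circles they approach [Im d]; on the circle of radius rho / 2 they are at most 2 M / (rho
    / 2) = 4 M / rho in modulus. *)
Lemma cauchy_estimate_im : forall phi rho M d, 0 < rho ->
  (forall z, Cmod z < rho -> exists l, cderiv phi z l) ->
  (forall z, Cmod z < rho -> Cmod (phi z) <= M) ->
  cderiv phi (RtoC 0) d -> Rabs (Im d) <= 4 * M / rho.
Proof.
  intros phi rho M d Hrho Hphi HM Hd. assert (HPI := PI_RGT_0).
  set (F := fun z => ((phi z - phi (RtoC 0)) * / z)%C).
  assert (HF : forall z, 0 < Cmod z < rho -> exists l, cderiv F z l).
  { intros z [Hz1 Hz2]. destruct (Hphi z Hz2) as [l Hl]. eexists. unfold F.
    apply cderiv_mult; [apply cderiv_minus; [exact Hl | apply cderiv_const]|].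
    apply cderiv_inv. now apply Cmod_gt_0. }
  apply Rnot_lt_le. intros Hlt.
  set (eps := (Rabs (Im d) - 4 * M / rho) / 2). assert (He : 0 < eps) by (unfold eps; lra).
  destruct (Hd eps He) as [dl [Hdl H]].
  (* The inner radius [a] is below both [dl], where the quotient is [eps]-close to [d], and the
     outer radius [b]. *)
  set (b := rho / 2). set (a := Rmin dl b / 2).
  assert (Hm : 0 < Rmin dl b) by (apply Rmin_pos; unfold b; lra).
  assert (Ha1 := Rmin_l dl b). assert (Ha2 := Rmin_r dl b).
  assert (E := circle_integral_const F rho a b HF ltac:(unfold a; lra) ltac:(unfold a; lra)
                 ltac:(unfold b; lra)).
  assert (Ia : ex_RInt (fun u => Im (F (polar a u))) 0 (2 * PI))
    by (apply polar_arc_integrable with rho; auto; unfold a, b in *; lra).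
  assert (Ib : ex_RInt (fun u => Im (F (polar b u))) 0 (2 * PI))
    by (apply polar_arc_integrable with rho; auto; unfold b in *; lra).
  assert (EC : RInt (fun _ => Im d) 0 (2 * PI) = 2 * PI * Im d).
  { rewrite RInt_const. unfold scal; simpl. unfold mult; simpl. ring. }
  assert (B1 : Rabs (RInt (fun u => Im (F (polar a u))) 0 (2 * PI) - 2 * PI * Im d)
                 <= (2 * PI - 0) * eps).
  { rewrite <- EC. apply RInt_close; [lra | exact Ia | apply ex_RInt_const |].
    intros u _. eapply Rle_trans; [apply Im_lipschitz|]. unfold F.
    assert (Hp : Cmod (polar a u) = a) by (apply Cmod_polar; unfold a; lra).
    assert (Hn : polar a u <> RtoC 0) by (apply Cmod_gt_0; rewrite Hp; unfold a; lra).
    specialize (H (polar a u)).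
    replace (polar a u - RtoC 0)%C with (polar a u) in H by ring.
    rewrite Hp in H. specialize (H ltac:(unfold a; lra)).
    replace ((phi (polar a u) - phi (RtoC 0)) * / polar a u - d)%C
      with ((phi (polar a u) - phi (RtoC 0) - d * polar a u) / polar a u)%C by (field; exact Hn).
    rewrite Cmod_div, Hp by exact Hn.
    apply Rmult_le_reg_r with a; [unfold a; lra|].
    unfold Rdiv at 1. rewrite Rmult_assoc, Rinv_l, Rmult_1_r by (unfold a; lra). exact H. }
  assert (B2 : Rabs (RInt (fun u => Im (F (polar b u))) 0 (2 * PI))
                 <= (2 * PI - 0) * (4 * M / rho)).
  { apply abs_RInt_le_const; [lra | exact Ib |].
    intros u _. eapply Rle_trans; [apply im_le_Cmod|]. unfold F.
    assert (Hp : Cmod (polar b u) = b) by (apply Cmod_polar; unfold b; lra).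
    assert (Hn : polar b u <> RtoC 0) by (apply Cmod_gt_0; rewrite Hp; unfold b; lra).
    rewrite Cmod_mult, Cmod_inv, Hp by exact Hn.
    apply Rmult_le_reg_r with b; [unfold b; lra|].
    rewrite Rmult_assoc, Rinv_l, Rmult_1_r by (unfold b; lra).
    replace (4 * M / rho * b) with (M + M) by (unfold b; field; lra).
    eapply Rle_trans; [apply Cmod_triangle|]. rewrite Cmod_opp.
    apply Rplus_le_compat; apply HM; [rewrite Hp; unfold b | rewrite Cmod_0]; lra. }
  rewrite <- E in B1. set (I := RInt _ _ _) in *.
  rewrite Rminus_0_r in B1, B2.
  assert (T := Rabs_triang (2 * PI * Im d - I) I).
  replace (2 * PI * Im d - I + I) with (2 * PI * Im d) in T by ring.
  rewrite Rabs_minus_sym in T. rewrite Rabs_mult, (Rabs_pos_eq (2 * PI)) in T by lra.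
  assert (2 * PI * Rabs (Im d) <= 2 * PI * (eps + 4 * M / rho)) by lra.
  apply Rmult_le_reg_l in H0; [|lra]. unfold eps in H0. lra.
Qed.

(** Multiplying by [Ci] turns the real part of the derivative into an imaginary part, so the
    previous estimate applies to both parts; adding them doubles the constant to 8. *)
Lemma cauchy_estimate : forall phi rho M a d,
  (forall z, Cmod (z - a) < rho -> exists l, cderiv phi z l) ->
  (forall z, Cmod (z - a) < rho -> Cmod (phi z) <= M) -> 0 < rho ->
  cderiv phi a d -> Cmod d <= 8 * M / rho.
Proof.
  intros phi rho M a d Hphi HM Hrho Hd.
  set (psi := fun z => phi (z + a)%C).
  assert (Hz : forall z, Cmod z < rho -> Cmod (z + a - a) < rho).
  { intros z Hz. now replace (z + a - a)%C with z by ring. }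
  assert (H1 : forall z, Cmod z < rho -> exists l, cderiv psi z l).
  { intros z Hz'. destruct (Hphi (z + a)%C (Hz z Hz')) as [l Hl]. exists l.
    now apply cderiv_shift. }
  assert (H2 : cderiv psi (RtoC 0) d).
  { apply cderiv_shift. now rewrite Cplus_0_l. }
  assert (I1 := cauchy_estimate_im psi rho M d Hrho H1 (fun z h => HM _ (Hz z h)) H2).
  assert (I2 : Rabs (Im (Ci * d)) <= 4 * M / rho).
  { apply (cauchy_estimate_im (fun z => Ci * psi z)%C); auto.
    - intros z Hz'. destruct (H1 z Hz') as [l Hl]. exists (Ci * l)%C. now apply cderiv_scal.
    - intros z Hz'. rewrite Cmod_mult, Cmod_Ci, Rmult_1_l. now apply HM, Hz.
    - now apply cderiv_scal. }
  replace (Im (Ci * d)) with (Re d) in I2 by (unfold Im, Re, Ci, Cmult; simpl; ring).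
  eapply Rle_trans; [apply Cmod_le_re_im|].
  replace (8 * M / rho) with (4 * M / rho + 4 * M / rho) by (field; lra). lra.
Qed.

(** With [p] equal to [Re] or [Im], this makes the real mean value theorem available along a
    segment. *)
Lemma derivable_along : forall (p : C -> R) (f : C -> C) a v t l,
  (forall z w, p (z - w)%C = p z - p w) -> (forall r z, p (RtoC r * z)%C = r * p z) ->
  (forall z, Rabs (p z) <= Cmod z) ->
  cderiv f (a + RtoC t * v)%C l ->
  derivable_pt_lim (fun s => p (f (a + RtoC s * v)%C)) t (p (l * v)%C).
Proof.
  intros p f a v t l Hm Hs Hp Hf eps He.
  assert (Hv := Cmod_ge_0 v).
  destruct (Hf (eps / (2 * (Cmod v + 1)))) as [d [Hd H]].
  { apply Rdiv_lt_0_compat; lra. }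
  assert (Hd' : 0 < d / (Cmod v + 1)) by (apply Rdiv_lt_0_compat; lra).
  exists (mkposreal _ Hd'). intros h Hh0 Hh. simpl in Hh.
  apply Rmult_lt_compat_r with (r := Cmod v + 1) in Hh; [|lra].
  replace (d / (Cmod v + 1) * (Cmod v + 1)) with d in Hh by (field; lra).
  assert (Ph := Rabs_pos_lt h Hh0).
  specialize (H (a + RtoC (t + h) * v)%C).
  replace (a + RtoC (t + h) * v - (a + RtoC t * v))%C with (RtoC h * v)%C in H
    by (rewrite RtoC_plus; ring).
  rewrite Cmod_mult, Cmod_R in H. specialize (H ltac:(nra)).
  set (y := f (a + RtoC (t + h) * v)%C) in *. set (x := f (a + RtoC t * v)%C) in *.
  replace ((p y - p x) / h - p (l * v)%C) with (p (y - x - l * (RtoC h * v))%C / h).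
  - unfold Rdiv. rewrite Rabs_mult, Rabs_inv.
    apply Rmult_lt_reg_r with (Rabs h); [easy|].
    rewrite Rmult_assoc, Rinv_l, Rmult_1_r by lra.
    eapply Rle_lt_trans; [apply Hp|]. eapply Rle_lt_trans; [exact H|].
    replace (eps / (2 * (Cmod v + 1)) * (Rabs h * Cmod v))
      with (eps * Rabs h * (Cmod v / (2 * (Cmod v + 1)))) by (field; lra).
    rewrite <- (Rmult_1_r (eps * Rabs h)) at 2.
    apply Rmult_lt_compat_l; [now apply Rmult_lt_0_compat|].
    apply Rmult_lt_reg_r with (2 * (Cmod v + 1)); [lra|].
    replace (Cmod v / (2 * (Cmod v + 1)) * (2 * (Cmod v + 1))) with (Cmod v) by (field; lra).
    lra.
  - replace (l * (RtoC h * v))%C with (RtoC h * (l * v))%C by ring.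
    rewrite !Hm, Hs. field. lra.
Qed.

Lemma disc_convex : forall a b r t, Cmod a < r -> Cmod b < r -> 0 <= t <= 1 ->
  Cmod (a + RtoC t * (b - a)) < r.
Proof.
  intros a b r t Ha Hb Ht.
  replace (a + RtoC t * (b - a))%C with (RtoC (1 - t) * a + RtoC t * b)%C
    by (rewrite RtoC_minus; ring).
  eapply Rle_lt_trans; [apply Cmod_triangle|].
  rewrite !Cmod_mult, !Cmod_R, !Rabs_pos_eq by lra.
  assert (Hm : Rmax (Cmod a) (Cmod b) < r) by now apply Rmax_lub_lt.
  assert (H1 := Rmax_l (Cmod a) (Cmod b)). assert (H2 := Rmax_r (Cmod a) (Cmod b)). nra.
Qed.

(** The mean value theorem is applied to the real and imaginary parts separately, at possibly
    different intermediate points; this costs the factor 2. *)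
Lemma mean_value_segment : forall f df D a b,
  (forall t, 0 <= t <= 1 -> cderiv f (a + RtoC t * (b - a))%C (df (a + RtoC t * (b - a))%C)) ->
  (forall t, 0 <= t <= 1 -> Cmod (df (a + RtoC t * (b - a))%C) <= D) ->
  Cmod (f b - f a) <= 2 * D * Cmod (b - a).
Proof.
  intros f df D a b Hf HD.
  assert (Key : forall p : C -> R,
    (forall z w, p (z - w)%C = p z - p w) -> (forall k z, p (RtoC k * z)%C = k * p z) ->
    (forall z, Rabs (p z) <= Cmod z) -> Rabs (p (f b - f a)%C) <= D * Cmod (b - a)).
  { intros p Hm Hs Hp.
    destruct (MVT_cor2 (fun t => p (f (a + RtoC t * (b - a))%C))
                (fun t => p (df (a + RtoC t * (b - a)) * (b - a))%C) 0 1) as [c [Hc1 Hc2]].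
    - lra.
    - intros t Ht. apply derivable_along; auto.
    - rewrite Hm. replace (a + RtoC 1 * (b - a))%C with b in Hc1 by ring.
      replace (a + RtoC 0 * (b - a))%C with a in Hc1 by ring.
      rewrite Hc1, Rminus_0_r, Rmult_1_r.
      eapply Rle_trans; [apply Hp|]. rewrite Cmod_mult.
      apply Rmult_le_compat_r; [apply Cmod_ge_0|]. apply HD. lra. }
  eapply Rle_trans; [apply Cmod_le_re_im|].
  assert (K1 := Key Re). assert (K2 := Key Im).
  specialize (K1 ltac:(intros; reflexivity)
    ltac:(intros; unfold Re, RtoC, Cmult; simpl; ring) re_le_Cmod).
  specialize (K2 ltac:(intros; reflexivity)
    ltac:(intros; unfold Im, RtoC, Cmult; simpl; ring) im_le_Cmod).
  lra.
Qed.

(* [phi] is Lipschitz by the first-order estimate; the same estimate for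
   [phi (z + k) - phi z] makes the derivative Lipschitz. *)
Lemma taylor_estimate : forall phi dphi rho M z, 0 < rho ->
  (forall z, Cmod z < rho -> cderiv phi z (dphi z)) ->
  (forall z, Cmod z < rho -> Cmod (phi z) <= M) ->
  Cmod z < rho / 4 ->
  Cmod (phi z - phi (RtoC 0) - dphi (RtoC 0) * z) <= 2048 * M / rho ^ 2 * Cmod z ^ 2.
Proof.
  intros phi dphi rho M z Hrho Hphi HM Hz.
  assert (HM0 : 0 <= M).
  { eapply Rle_trans; [apply Cmod_ge_0 | apply (HM (RtoC 0)); rewrite Cmod_0; lra]. }
  assert (B1 : forall w, Cmod w < rho / 2 -> Cmod (dphi w) <= 16 * M / rho).
  { intros w Hw. replace (16 * M / rho) with (8 * M / (rho / 2)) by (field; lra).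
    assert (Hball : forall y, Cmod (y - w) < rho / 2 -> Cmod y < rho).
    { intros y Hy. replace y with ((y - w) + w)%C by ring.
      eapply Rle_lt_trans; [apply Cmod_triangle | lra]. }
    apply (cauchy_estimate phi) with w; auto; try lra.
    - intros y Hy. exists (dphi y). auto.
    - apply Hphi. lra. }
  assert (B2 : forall a b, Cmod a < rho / 2 -> Cmod b < rho / 2 ->
    Cmod (phi b - phi a) <= 32 * M / rho * Cmod (b - a)).
  { intros a b Ha Hb. replace (32 * M / rho) with (2 * (16 * M / rho)) by (field; lra).
    apply (mean_value_segment phi dphi); intros t Ht;
      assert (Hd := disc_convex a b (rho / 2) t Ha Hb Ht); [apply Hphi; lra | now apply B1]. }
  assert (B3 : forall k, Cmod k < rho / 4 ->
    Cmod (dphi k - dphi (RtoC 0)) <= 1024 * M / rho ^ 2 * Cmod k).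
  { intros k Hk.
    assert (Hball : forall y, Cmod (y - RtoC 0) < rho / 4 -> Cmod y < rho / 4 /\ Cmod (y + k) < rho / 2).
    { intros y Hy. replace (y - RtoC 0)%C with y in Hy by ring. split; [easy|].
      eapply Rle_lt_trans; [apply Cmod_triangle | lra]. }
    (* By [B2] the function [phi (y + k) - phi y] is at most 32 M |k| / rho on the disc of radius
       rho / 4. The first-order estimate on that disc gives 8 * 4 * 32 = 1024. *)
    replace (1024 * M / rho ^ 2 * Cmod k) with (8 * (32 * M / rho * Cmod k) / (rho / 4))
      by (field; lra).
    apply (cauchy_estimate (fun y => phi (y + k) - phi y)%C) with (RtoC 0); try lra.
    - intros y Hy. apply Hball in Hy. eexists. apply cderiv_minus.
      + apply cderiv_shift. apply Hphi. lra.
      + apply Hphi. lra.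
    - intros y Hy. apply Hball in Hy.
      replace (Cmod k) with (Cmod (y + k - y)) by (f_equal; ring). apply B2; lra.
    - apply cderiv_minus.
      + apply cderiv_shift. rewrite Cplus_0_l. apply Hphi. lra.
      + apply Hphi. rewrite Cmod_0. lra. }
  assert (HK : 0 <= 1024 * M / rho ^ 2).
  { apply Rmult_le_pos; [lra|]. left. apply Rinv_0_lt_compat. now apply pow_lt. }
  (* After removal of the linear part the derivative at [w] is [dphi w - dphi 0], which [B3]
     controls on the segment from 0 to [z]. [mean_value_segment] then doubles 1024. *)
  replace (phi z - phi (RtoC 0) - dphi (RtoC 0) * z)%C
    with (phi z - dphi (RtoC 0) * z - (phi (RtoC 0) - dphi (RtoC 0) * RtoC 0))%C by ring.
  assert (Pz := Cmod_ge_0 z).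
  replace (2048 * M / rho ^ 2 * Cmod z ^ 2)
    with (2 * (1024 * M / rho ^ 2 * Cmod z) * Cmod (z - RtoC 0))
    by (replace (z - RtoC 0)%C with z by ring; field; lra).
  assert (Hseg : forall t, 0 <= t <= 1 -> Cmod (RtoC 0 + RtoC t * (z - RtoC 0)) <= Cmod z).
  { intros t Ht. replace (RtoC 0 + RtoC t * (z - RtoC 0))%C with (RtoC t * z)%C by ring.
    rewrite Cmod_mult, Cmod_R, Rabs_pos_eq by lra. nra. }
  apply (mean_value_segment (fun w => phi w - dphi (RtoC 0) * w)%C
    (fun w => dphi w - dphi (RtoC 0))%C); intros t Ht; specialize (Hseg t Ht);
    set (w := (RtoC 0 + RtoC t * (z - RtoC 0))%C) in *.
  - apply cderiv_minus; [apply Hphi; lra|].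
    assert (A := cderiv_affine (RtoC 0) (dphi (RtoC 0)) w). intros eps He.
    destruct (A eps He) as [d [Hd H]]. exists d. split; [easy|]. intros y Hy.
    specialize (H y Hy). unfold affine in H. now rewrite !Cplus_0_l in H.
  - eapply Rle_trans; [apply B3; lra|]. apply Rmult_le_compat_l; lra.
Qed.

(** * Ultrafilter limits *)

(** An ultrafilter finer than [eventually] is free. The rest translates between two notions of
    proper filter: one excludes the empty set, the other asks every member to be inhabited, and
    classical logic identifies them. *)
Lemma free_ultrafilter : exists U : (nat -> Prop) -> Prop,
  ProperFilter U /\ (forall P, U P \/ U (fun n => ~ P n)) /\
  (forall P, eventually P -> U P).
Proof.
  assert (He : filter.ProperFilter (eventually : (nat -> Prop) -> Prop)).
  { constructor.
    - intros [N HN]. exact (HN N (le_n N)).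
    - constructor.
      + exists 0%nat. intros n _. exact Logic.I.
      + exact (fun P Q HP HQ => filter_and P Q HP HQ).
      + exact (fun P Q => filter_imp P Q). }
  destruct (filter.ultraFilterLemma He) as [U [HU Hle]].
  assert (HP := @filter.ultra_proper _ _ HU).
  assert (HF := @filter.filter_filter _ _ HP).
  exists U. split; [|split].
  - constructor.
    + intros P HUP. apply NNPP. intros Hn.
      apply (@filter.filter_not_empty _ _ HP).
      apply (@filter.filterS _ _ HF P); [|exact HUP].
      intros n Hn'. apply Hn. now exists n.
    + constructor.
      * exact (@filter.filterT _ _ HF).
      * exact (@filter.filterI _ _ HF).
      * exact (@filter.filterS _ _ HF).
  - intros P. exact (filter.in_ultra_setVsetC P HU).
  - exact Hle.
Qed.

Section UltrafilterLimits.

Variable U : (nat -> Prop) -> Prop.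
Hypothesis U_proper : ProperFilter U.
Hypothesis U_ultra : forall P, U P \/ U (fun n => ~ P n).

Definition is_ulim (a : nat -> C) (l : C) : Prop :=
  forall eps, 0 < eps -> U (fun n => Cmod (a n - l) < eps).

(** Choice makes the limit a total function of the sequence. The value is meaningful only when a
    limit exists, in particular for bounded sequences. *)
Definition ulim (a : nat -> C) : C := epsilon (inhabits (RtoC 0)) (is_ulim a).

(** The limit is the supremum of the [r] that lie below [a n] for [U]-many [n]. That [a n] exceeds
    [l - eps] on a set of [U] comes from the supremum; that it stays below [l + eps] uses the
    ultrafilter dichotomy. *)
Lemma ultra_bounded_real : forall (a : nat -> R) M, (forall n, Rabs (a n) <= M) ->
  exists l, forall eps, 0 < eps -> U (fun n => Rabs (a n - l) < eps).
Proof.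
  intros a M HM.
  destruct (completeness (fun r => U (fun n => r <= a n))) as [l [Hl1 Hl2]].
  - exists M. intros r Hr. destruct (filter_ex _ Hr) as [n Hn].
    specialize (HM n). apply Rabs_le_between in HM. lra.
  - exists (- M). apply filter_forall. intros n. specialize (HM n).
    apply Rabs_le_between in HM. lra.
  - exists l. intros eps He.
    assert (H1 : U (fun n => l - eps < a n)).
    { apply NNPP. intros Hn. assert (l <= l - eps); [|lra].
      apply Hl2. intros r Hr. apply Rnot_lt_le. intros Hlt. apply Hn.
      revert Hr. apply filter_imp. intros n Hn'. lra. }
    assert (H2 : U (fun n => a n < l + eps)).
    { destruct (U_ultra (fun n => a n < l + eps)) as [H|H]; [easy|].
      assert (l + eps <= l); [|lra]. apply Hl1. revert H.
      apply filter_imp. intros n Hn. lra. }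
    generalize (filter_and _ _ H1 H2). apply filter_imp.
    intros n [A B]. apply Rabs_lt_between. lra.
Qed.

Lemma ulim_correct : forall a M, (forall n, Cmod (a n) <= M) -> is_ulim a (ulim a).
Proof.
  intros a M HM. unfold ulim. apply epsilon_spec.
  destruct (ultra_bounded_real (fun n => Re (a n)) M) as [x Hx].
  { intros n. eapply Rle_trans; [apply re_le_Cmod | apply HM]. }
  destruct (ultra_bounded_real (fun n => Im (a n)) M) as [y Hy].
  { intros n. eapply Rle_trans; [apply im_le_Cmod | apply HM]. }
  exists (x, y). intros eps He. assert (He2 : 0 < eps / 2) by lra.
  generalize (filter_and _ _ (Hx _ He2) (Hy _ He2)).
  apply filter_imp. intros n [A B].
  eapply Rle_lt_trans; [apply Cmod_le_re_im|].
  change (Rabs (Re (a n) - x) + Rabs (Im (a n) - y) < eps). lra.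
Qed.

(** Closed discs are closed under limits. With [c = 0] this transfers uniform bounds, including
    those on Taylor remainders, to the limit. *)
Lemma is_ulim_dist : forall a l c B,
  is_ulim a l -> U (fun n => Cmod (a n - c) <= B) -> Cmod (l - c) <= B.
Proof.
  intros a l c B Ha HB. apply Rnot_lt_le. intros Hlt.
  specialize (Ha (Cmod (l - c) - B) ltac:(lra)).
  destruct (filter_ex _ (filter_and _ _ Ha HB)) as [n [H1 H2]].
  assert (T := Cmod_triangle (a n - c) (- (a n - l))%C).
  replace (a n - c + - (a n - l))%C with (l - c)%C in T by ring.
  rewrite Cmod_opp in T. lra.
Qed.

Lemma is_ulim_unique : forall a l m, is_ulim a l -> is_ulim a m -> l = m.
Proof.
  intros a l m Hl Hm.
  assert (H : Cmod (l - m) <= 0).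
  { apply le_epsilon. intros eps He. rewrite Rplus_0_l. apply (is_ulim_dist a); auto.
    generalize (Hm eps He). apply filter_imp. intros n Hn. lra. }
  assert (H0 := Cmod_ge_0 (l - m)).
  assert (E := Cmod_eq_0 (l - m)%C ltac:(lra)).
  replace l with (l - m + m)%C by ring. rewrite E. ring.
Qed.

Lemma ulim_eq : forall a l, is_ulim a l -> ulim a = l.
Proof.
  intros a l H. apply is_ulim_unique with a; auto.
  unfold ulim. apply epsilon_spec. now exists l.
Qed.

Lemma is_ulim_ext : forall a b l, U (fun n => a n = b n) -> is_ulim a l -> is_ulim b l.
Proof.
  intros a b l H Ha eps He. generalize (filter_and _ _ H (Ha eps He)).
  apply filter_imp. intros n [E Hn]. now rewrite <- E.
Qed.

Lemma is_ulim_const : forall c, is_ulim (fun _ => c) c.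
Proof.
  intros c eps He. apply filter_forall. intros n.
  replace (c - c)%C with (RtoC 0) by ring. now rewrite Cmod_0.
Qed.

Lemma is_ulim_plus : forall a b l m, is_ulim a l -> is_ulim b m ->
  is_ulim (fun n => a n + b n)%C (l + m)%C.
Proof.
  intros a b l m Ha Hb eps He. assert (He2 : 0 < eps / 2) by lra.
  generalize (filter_and _ _ (Ha _ He2) (Hb _ He2)).
  apply filter_imp. intros n [H1 H2].
  replace (a n + b n - (l + m))%C with ((a n - l) + (b n - m))%C by ring.
  eapply Rle_lt_trans; [apply Cmod_triangle | lra].
Qed.

Lemma is_ulim_mult : forall a b l m, is_ulim a l -> is_ulim b m ->
  is_ulim (fun n => a n * b n)%C (l * m)%C.
Proof.
  intros a b l m Ha Hb eps He.
  assert (Pl := Cmod_ge_0 l). assert (Pm := Cmod_ge_0 m).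
  set (K := Cmod l + Cmod m + 1). assert (HK : 0 < K) by (unfold K; lra).
  set (e := Rmin 1 (eps / K)).
  assert (He' : 0 < e) by (apply Rmin_pos; [lra | now apply Rdiv_lt_0_compat]).
  generalize (filter_and _ _ (Ha e He') (Hb e He')).
  apply filter_imp. intros n [H1 H2].
  assert (E1 := Rmin_l 1 (eps / K)). assert (E2 := Rmin_r 1 (eps / K)). fold e in E1, E2.
  replace (a n * b n - l * m)%C
    with ((a n - l) * (b n - m) + l * (b n - m) + (a n - l) * m)%C by ring.
  eapply Rle_lt_trans; [apply Cmod_triangle|].
  eapply Rle_lt_trans; [apply Rplus_le_compat_r, Cmod_triangle|].
  rewrite !Cmod_mult.
  set (x := Cmod (a n - l)) in *. set (y := Cmod (b n - m)) in *.
  assert (Px : 0 <= x) by apply Cmod_ge_0. assert (Py : 0 <= y) by apply Cmod_ge_0.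
  apply Rlt_le_trans with (e * K).
  - unfold K. assert (x * y <= e * y) by (apply Rmult_le_compat_r; lra).
    assert (e * y < e * 1) by (apply Rmult_lt_compat_l; lra).
    assert (Cmod l * y <= Cmod l * e) by (apply Rmult_le_compat_l; lra).
    assert (x * Cmod m <= e * Cmod m) by (apply Rmult_le_compat_r; lra). lra.
  - apply Rmult_le_compat_r with (r := K) in E2; [|lra].
    replace (eps / K * K) with eps in E2 by (field; lra). lra.
Qed.

End UltrafilterLimits.

(** * Uniform Frechet estimates and holomorphy of ultrafilter limits *)

Section FrechetEstimate.

Context {E : NormedModule C_AbsRing}.

Lemma filterdiff_remainder : forall (f L : E -> C) (y : E),
  filterdiff (V := C_NormedModule) f (locally y) L ->
  forall eps, 0 < eps -> exists delta, 0 < delta /\ forall u, norm u < delta ->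
    Cmod (f (plus y u) - f y - L u) <= eps * norm u.
Proof.
  intros f L y [_ H] eps He.
  specialize (H y (fun P HP => HP) (mkposreal eps He)).
  apply locally_norm_le_locally in H. destruct H as [d Hd].
  exists d. split; [apply cond_pos|]. intros u Hu.
  assert (Eu : minus (plus y u) y = u).
  { unfold minus. rewrite (plus_comm y u), <- plus_assoc.
    eapply eq_trans; [apply f_equal, plus_opp_r | apply plus_zero_r]. }
  specialize (Hd (plus y u)). unfold ball_norm in Hd. rewrite Eu in Hd.
  exact (Hd Hu).
Qed.

(** Restriction to a complex line: complex linearity of [L] turns its value at [v] into the
    derivative of a function of one variable. *)
Lemma cderiv_directional : forall (f L : E -> C) (x v : E) (z : C),
  filterdiff (V := C_NormedModule) f (locally (plus x (scal z v))) L ->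
  cderiv (fun t : C => f (plus x (scal t v))) z (L v).
Proof.
  intros f L x v z H eps He. assert (Hv := norm_ge_0 v).
  destruct (filterdiff_remainder _ _ _ H (eps / (norm v + 1))) as [d [Hd Hd']].
  { apply Rdiv_lt_0_compat; lra. }
  exists (d / (norm v + 1)). split; [apply Rdiv_lt_0_compat; lra|]. intros w Hw.
  apply Rmult_lt_compat_r with (r := norm v + 1) in Hw; [|lra].
  replace (d / (norm v + 1) * (norm v + 1)) with d in Hw by (field; lra).
  assert (Pw := Cmod_ge_0 (w - z)).
  assert (Hn : norm (scal (w - z)%C v) <= Cmod (w - z) * norm v)
    by exact (norm_scal (K := C_AbsRing) (w - z)%C v).
  specialize (Hd' (scal (w - z)%C v) ltac:(lra)).
  assert (E1 : plus (plus x (scal z v)) (scal (w - z)%C v) = plus x (scal w v)).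
  { rewrite <- plus_assoc. f_equal. etransitivity.
    - symmetry. exact (scal_distr_r (K := C_Ring) (V := E) z (w - z)%C v).
    - f_equal. change (z + (w - z) = w)%C. ring. }
  assert (E2 : L (scal (w - z)%C v) = (L v * (w - z))%C).
  { destruct H as [HL _]. rewrite (linear_scal L HL). apply Cmult_comm. }
  rewrite E1, E2 in Hd'. eapply Rle_trans; [exact Hd'|].
  eapply Rle_trans; [apply Rmult_le_compat_l; [|exact Hn]|].
  - left. apply Rdiv_lt_0_compat; lra.
  - replace (eps / (norm v + 1) * (Cmod (w - z) * norm v))
      with (eps * Cmod (w - z) * (norm v / (norm v + 1))) by (field; lra).
    rewrite <- (Rmult_1_r (eps * Cmod (w - z))) at 2.
    apply Rmult_le_compat_l; [apply Rmult_le_pos; lra|].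
    apply Rmult_le_reg_r with (norm v + 1); [lra|].
    replace (norm v / (norm v + 1) * (norm v + 1)) with (norm v) by (field; lra). lra.
Qed.

(** On the complex line through [x] in the direction u / |u|, the disc of radius 1 - |x| stays in
    the ball, so the one-variable estimates apply at the parameter |u|. The constants depend only on
    [M] and [x], not on [f], which is what a passage to the limit requires. *)
Lemma frechet_estimate : forall (f : E -> C) (M : R) (x : E),
  holomorphic_on (F := C_NormedModule) unit_ball f ->
  (forall y, unit_ball y -> Cmod (f y) <= M) -> unit_ball x ->
  exists L, is_linear (V := C_NormedModule) L /\
    (forall u, Cmod (L u) <= 8 * M / (1 - norm x) * norm u) /\
    (forall u, norm u < (1 - norm x) / 4 ->
      Cmod (f (plus x u) - f x - L u) <= 2048 * M / (1 - norm x) ^ 2 * norm u ^ 2).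
Proof.
  intros f M x Hf HM Hx.
  (* [holomorphic_on] only asserts that a derivative exists at each point; the one-variable
     estimates need a derivative function along the whole disc. *)
  set (D := fun y => epsilon (inhabits (fun _ : E => RtoC 0))
              (filterdiff (V := C_NormedModule) f (locally y))).
  assert (HD : forall y, unit_ball y -> filterdiff (V := C_NormedModule) f (locally y) (D y)).
  { intros y Hy. apply epsilon_spec. exact (Hf y Hy). }
  unfold unit_ball in Hx. set (rho := 1 - norm x). assert (Hrho : 0 < rho) by (unfold rho; lra).
  assert (Lx := proj1 (HD x Hx)).
  assert (Hball : forall (v : E) (z : C), norm v <= 1 -> Cmod z < rho ->
    unit_ball (plus x (scal z v))).
  { intros v z Hv Hz. unfold unit_ball. eapply Rle_lt_trans; [apply norm_triangle|].
    assert (H : norm (scal z v) <= Cmod z * norm v) by exact (norm_scal (K := C_AbsRing) z v).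
    assert (Cmod z * norm v <= Cmod z * 1) by (apply Rmult_le_compat_l; [apply Cmod_ge_0 | easy]).
    unfold rho in Hz. lra. }
  exists (D x).
  assert (Key : forall u, norm u <> 0 ->
    Cmod (D x u) <= 8 * M / rho * norm u /\
    (norm u < rho / 4 -> Cmod (f (plus x u) - f x - D x u) <= 2048 * M / rho ^ 2 * norm u ^ 2)).
  { intros u Hu. assert (Pu := norm_ge_0 u).
    set (v := scal (RtoC (/ norm u)) u).
    assert (Hv : norm v <= 1).
    { eapply Rle_trans; [apply norm_RtoC_scal; left; apply Rinv_0_lt_compat; lra|].
      rewrite Rinv_l by exact Hu. apply Rle_refl. }
    set (phi := fun t : C => f (plus x (scal t v))).
    set (dphi := fun t : C => D (plus x (scal t v)) v).
    assert (Hphi : forall z, Cmod z < rho -> cderiv phi z (dphi z)).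
    { intros z Hz. apply cderiv_directional. apply HD. now apply Hball. }
    assert (HphiM : forall z, Cmod z < rho -> Cmod (phi z) <= M).
    { intros z Hz. apply HM. now apply Hball. }
    assert (E0 : plus x (scal (RtoC 0) v) = x).
    { transitivity (plus x zero); [f_equal; exact (scal_zero_l (K := C_Ring) (V := E) v)|].
      apply plus_zero_r. }
    assert (Eu : scal (RtoC (norm u)) v = u).
    { unfold v. etransitivity; [apply (scal_assoc (K := C_Ring) (V := E))|].
      change (scal (RtoC (norm u) * RtoC (/ norm u))%C u = u).
      rewrite <- RtoC_mult, Rinv_r by easy. exact (scal_one (K := C_Ring) (V := E) u). }
    assert (Ed : dphi (RtoC 0) = D x v) by (unfold dphi; now rewrite E0).
    assert (EL : (D x v * RtoC (norm u))%C = D x u).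
    { rewrite <- Eu at 2. rewrite (linear_scal _ Lx). apply Cmult_comm. }
    assert (Cu : Cmod (RtoC (norm u)) = norm u) by (rewrite Cmod_R; now apply Rabs_pos_eq).
    split.
    - rewrite <- EL, Cmod_mult, Cu. apply Rmult_le_compat_r; [easy|].
      rewrite <- Ed. apply (cauchy_estimate phi) with (RtoC 0); auto.
      + intros z Hz. replace (z - RtoC 0)%C with z in Hz by ring. eexists. now apply Hphi.
      + intros z Hz. replace (z - RtoC 0)%C with z in Hz by ring. now apply HphiM.
      + apply Hphi. now rewrite Cmod_0.
    - intros Hlt.
      assert (T := taylor_estimate phi dphi rho M (RtoC (norm u)) Hrho Hphi HphiM).
      rewrite Cu, Ed, EL in T. unfold phi in T. rewrite Eu, E0 in T. now apply T. }
  split; [exact Lx|].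
  assert (HM0 : 0 <= M).
  { eapply Rle_trans; [apply Cmod_ge_0 | now apply (HM x)]. }
  (* A vector of norm zero has no direction to normalize and is treated by hand. *)
  split; intros u; destruct (Req_dec (norm u) 0) as [H0|H0]; try now apply Key.
  - rewrite (norm_eq_zero _ H0), (linear_zero _ Lx), norm_zero.
    change (Cmod (RtoC 0) <= 8 * M / rho * 0). rewrite Cmod_0. lra.
  - intros _. rewrite (norm_eq_zero _ H0), (linear_zero _ Lx), norm_zero, plus_zero_r.
    change (Cmod (f x - f x - RtoC 0) <= 2048 * M / rho ^ 2 * 0 ^ 2).
    replace (f x - f x - RtoC 0)%C with (RtoC 0) by ring. rewrite Cmod_0. lra.
Qed.

(* The derivative of the limit is the limit of the derivatives: the remainders in
   [frechet_estimate] do not depend on the index. *)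
Lemma holo_ulim : forall U, ProperFilter U -> (forall P, U P \/ U (fun n => ~ P n)) ->
  forall (f : nat -> E -> C) (M : R),
  (forall n, holomorphic_on (F := C_NormedModule) unit_ball (f n)) ->
  (forall n x, unit_ball x -> Cmod (f n x) <= M) ->
  holomorphic_on (F := C_NormedModule) unit_ball (fun x => ulim U (fun n => f n x)).
Proof.
  intros U UP UU f M Hf HM x Hx.
  assert (HL := fun n => constructive_indefinite_description _
                  (frechet_estimate (f n) M x (Hf n) (HM n) Hx)).
  set (l := (fun n => proj1_sig (HL n)) : nat -> E -> C).
  assert (Hl1 : forall n, is_linear (V := C_NormedModule) (l n)) by (intros n; apply (proj2_sig (HL n))).
  assert (Hl2 : forall n u, Cmod (l n u) <= 8 * M / (1 - norm x) * norm u)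
    by (intros n; apply (proj2_sig (HL n))).
  assert (Hl3 : forall n u, norm u < (1 - norm x) / 4 ->
      Cmod (f n (plus x u) - f n x - l n u) <= 2048 * M / (1 - norm x) ^ 2 * norm u ^ 2)
    by (intros n; apply (proj2_sig (HL n))).
  clearbody l. clear HL.
  assert (HM0 : 0 <= M).
  { eapply Rle_trans; [apply Cmod_ge_0 | now apply (HM 0%nat x)]. }
  unfold unit_ball in Hx. set (rho := 1 - norm x) in *.
  assert (Hrho : 0 < rho) by (unfold rho; lra).
  assert (Lim : forall u, is_ulim U (fun n => l n u) (ulim U (fun n => l n u))).
  { intros u. apply ulim_correct with (8 * M / rho * norm u); auto. }
  assert (Limf : forall y, unit_ball y -> is_ulim U (fun n => f n y) (ulim U (fun n => f n y))).
  { intros y Hy. apply ulim_correct with M; auto. }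
  set (K := 2048 * M / rho ^ 2).
  assert (HK : 0 <= K).
  { apply Rmult_le_pos; [lra|]. left. apply Rinv_0_lt_compat. now apply pow_lt. }
  assert (HB : 0 <= 8 * M / rho).
  { apply Rmult_le_pos; [lra|]. left. now apply Rinv_0_lt_compat. }
  exists (fun u => ulim U (fun n => l n u)). split; [split|].
  - intros u v. apply ulim_eq; auto.
    apply (is_ulim_ext U UP (fun n => l n u + l n v)%C).
    + apply filter_forall. intros n. symmetry. exact (linear_plus _ (Hl1 n) u v).
    + now apply is_ulim_plus.
  - intros k u. apply ulim_eq; auto.
    apply (is_ulim_ext U UP (fun n => k * l n u)%C).
    + apply filter_forall. intros n. symmetry. exact (linear_scal _ (Hl1 n) k u).
    + apply is_ulim_mult; auto. now apply is_ulim_const.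
  (* [is_linear] asks for a strictly positive constant while [M] may be 0, hence the added 1. *)
  - exists (8 * M / rho + 1). split; [lra|]. intros u.
    change (Cmod (ulim U (fun n => l n u)) <= (8 * M / rho + 1) * norm u).
    assert (H := norm_ge_0 u).
    apply Rle_trans with (8 * M / rho * norm u); [|nra].
    assert (A := is_ulim_dist U UP _ _ (RtoC 0) (8 * M / rho * norm u) (Lim u)).
    replace (ulim U (fun n => l n u) - RtoC 0)%C with (ulim U (fun n => l n u)) in A by ring.
    apply A. apply filter_forall. intros n.
    replace (l n u - RtoC 0)%C with (l n u) by ring. apply Hl2.
  - intros x' Hx'. apply is_filter_lim_locally_unique in Hx'. subst x'.
    intros eps. apply locally_le_locally_norm.
    (* The first radius is that of the remainder estimate; the second turns K |u|^2 into at most eps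
       |u|. *)
    assert (Hd : 0 < Rmin (rho / 4) (eps / (K + 1))).
    { apply Rmin_pos; [lra|]. apply Rdiv_lt_0_compat; [apply cond_pos | lra]. }
    exists (mkposreal _ Hd). intros y Hy. unfold ball_norm in Hy. simpl in Hy.
    apply Rmin_Rgt in Hy. destruct Hy as [Hy1 Hy2].
    assert (Ey : y = plus x (minus y x)) by (symmetry; exact (plus_minus_r E x y)).
    set (u := minus y x) in *. rewrite Ey.
    change (Cmod (ulim U (fun n => f n (plus x u)) - ulim U (fun n => f n x)
                  - ulim U (fun n => l n u)) <= eps * norm u).
    assert (Pu := norm_ge_0 u).
    apply Rle_trans with (K * norm u ^ 2).
    + assert (Hxu : unit_ball (plus x u)).
      { unfold unit_ball. eapply Rle_lt_trans; [apply norm_triangle|]. unfold rho in Hy1. lra. }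
      match goal with |- Cmod ?a <= _ => replace a with (a - RtoC 0)%C by ring end.
      (* The remainder of the limit is the limit of the remainders, written with factors -1 so that
         the sum and product rules apply. *)
      apply (is_ulim_dist U UP
        (fun n => f n (plus x u) + RtoC (-1) * f n x + RtoC (-1) * l n u)%C).
      * match goal with |- is_ulim U _ (?a - ?b - ?c)%C =>
          replace (a - b - c)%C with (a + RtoC (-1) * b + RtoC (-1) * c)%C by ring end.
        repeat apply is_ulim_plus; auto; apply is_ulim_mult; auto; apply is_ulim_const; auto.
      * apply filter_forall. intros n.
        replace (f n (plus x u) + RtoC (-1) * f n x + RtoC (-1) * l n u - RtoC 0)%C
          with (f n (plus x u) - f n x - l n u)%C by ring. now apply Hl3.
    + apply Rmult_lt_compat_r with (r := K + 1) in Hy2; [|lra].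
      replace (eps / (K + 1) * (K + 1)) with (pos eps) in Hy2 by (field; lra).
      replace (K * norm u ^ 2) with (norm u * K * norm u) by ring.
      apply Rmult_le_compat_r; [easy|]. lra.
Qed.

End FrechetEstimate.

(** * Blocks of coordinates in l2 *)

Lemma ell2_norm_shift_le : forall (x y : ell2) (m : nat),
  (forall k, (k <= m)%nat -> x k = RtoC 0) ->
  (forall k, Cmod (x (S m + k)%nat) <= Cmod (y k)) -> ell2_norm x <= ell2_norm y.
Proof.
  intros x y m H0 H. apply Rsqr_incr_0_var; [|apply ell2_norm_pos].
  rewrite !Rsqr_pow2, !ell2_norm_sqr.
  rewrite (Series_incr_n _ (S m)) by (try lia; apply coef_summable). simpl pred.
  rewrite (sum_eq _ (fun _ => 0) m).
  - rewrite sum_cte, Rmult_0_l, Rplus_0_l. apply Series_le; [|apply coef_summable].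
    intros k. split; [apply pow2_ge_0|]. apply pow_incr. split; [apply Cmod_ge_0 | apply H].
  - intros i Hi. rewrite H0 by easy. rewrite Cmod_0. ring.
Qed.

Lemma norm_basis : forall n, ell2_norm (basis n) = 1.
Proof.
  intros n. unfold ell2_norm. rewrite (Series_single _ n).
  - simpl. unfold delta. destruct (Nat.eq_dec n n); [|easy].
    rewrite Cmod_1. replace (1 * (1 * 1)) with 1 by ring. apply sqrt_1.
  - intros k Hk. simpl. unfold delta. destruct (Nat.eq_dec k n); [easy|].
    rewrite Cmod_0. ring.
Qed.

(* The first n coordinates of y, moved to the positions n^2 + 1, ..., n^2 + n.
   Together with the marker position n^2 these blocks are disjoint. *)
Definition place_coef (n : nat) (y : nat -> C) (k : nat) : C :=
  if le_lt_dec k (n * n) then RtoC 0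
  else if le_lt_dec k (n * n + n) then y (k - n * n - 1)%nat else RtoC 0.

Lemma place_summable : forall n y, square_summable (place_coef n y).
Proof.
  intros n y. apply square_summable_finite with (S (n * n + n)). intros k Hk.
  unfold place_coef. destruct (le_lt_dec k (n * n)); [easy|].
  destruct (le_lt_dec k (n * n + n)); [lia | easy].
Qed.

Definition place (n : nat) (y : ell2) : ell2 := Ell2 (place_coef n y) (place_summable n y).

Lemma place_in : forall n (y : ell2) j, (j < n)%nat -> place n y (n * n + 1 + j)%nat = y j.
Proof.
  intros n y j Hj. simpl. unfold place_coef.
  destruct (le_lt_dec (n * n + 1 + j) (n * n)); [lia|].
  destruct (le_lt_dec (n * n + 1 + j) (n * n + n)); [|lia]. f_equal. lia.
Qed.

Lemma place_out : forall n (y : ell2) k, (k <= n * n \/ n * n + n < k)%nat ->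
  place n y k = RtoC 0.
Proof.
  intros n y k Hk. simpl. unfold place_coef.
  destruct (le_lt_dec k (n * n)); [easy|].
  destruct (le_lt_dec k (n * n + n)); [lia | easy].
Qed.

Lemma norm_place_le : forall n y, ell2_norm (place n y) <= ell2_norm y.
Proof.
  intros n y. apply ell2_norm_shift_le with (n * n)%nat.
  - intros k Hk. apply place_out. now left.
  - intros k. destruct (le_lt_dec n k).
    + rewrite place_out by lia. rewrite Cmod_0. apply Cmod_ge_0.
    + replace (S (n * n) + k)%nat with (n * n + 1 + k)%nat by lia.
      rewrite place_in by easy. apply Rle_refl.
Qed.

Lemma is_linear_place : forall n,
  is_linear (U := ell2_NormedModule) (V := ell2_NormedModule) (place n).
Proof.
  intros n. split.
  - intros x y. apply ell2_ext. intros k. simpl. unfold place_coef.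
    destruct (le_lt_dec k (n * n)); [|destruct (le_lt_dec k (n * n + n))]; simpl; ring.
  - intros a x. apply ell2_ext. intros k. simpl. unfold place_coef.
    destruct (le_lt_dec k (n * n)); [|destruct (le_lt_dec k (n * n + n))]; simpl; ring.
  - exists 1. split; [lra|]. intros x. rewrite Rmult_1_l. apply norm_place_le.
Qed.

(** The marker at [n * n] is a known nonzero factor: a product of two coordinates, one of them the
    marker, becomes linear in [y]. *)
Definition block_vector (c : R) (n : nat) (y : ell2) : ell2 :=
  plus (scal (RtoC c) (basis (n * n))) (scal (RtoC c) (place n y)).

Lemma norm_block_vector : forall c n y, 0 <= c ->
  norm (block_vector c n y) <= c + c * norm y.
Proof.
  intros c n y Hc. eapply Rle_trans; [apply ell2_norm_triangle|].
  assert (H1 : ell2_norm (scal (RtoC c) (basis (n * n))) <= c * ell2_norm (basis (n * n)))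
    by exact (norm_RtoC_scal (E := ell2_NormedModule) c (basis (n * n)) Hc).
  assert (H2 : ell2_norm (scal (RtoC c) (place n y)) <= c * ell2_norm (place n y))
    by exact (norm_RtoC_scal (E := ell2_NormedModule) c (place n y) Hc).
  rewrite norm_basis in H1.
  assert (H3 := Rmult_le_compat_l c _ _ Hc (norm_place_le n y)).
  change (norm y) with (ell2_norm y). lra.
Qed.

Lemma block_vector_marker : forall c n y, block_vector c n y (n * n)%nat = RtoC c.
Proof.
  intros c n y. change (RtoC c * delta (n * n) (n * n) + RtoC c * place n y (n * n)%nat = RtoC c)%C.
  rewrite place_out by lia. unfold delta. destruct (Nat.eq_dec (n * n) (n * n)); [ring | easy].
Qed.

Lemma block_vector_in : forall c n y j, (j < n)%nat ->
  block_vector c n y (n * n + 1 + j)%nat = (RtoC c * y j)%C.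
Proof.
  intros c n y j Hj.
  change (RtoC c * delta (n * n) (n * n + 1 + j) + RtoC c * place n y (n * n + 1 + j)%nat
          = RtoC c * y j)%C.
  rewrite place_in by easy. unfold delta. destruct (Nat.eq_dec (n * n + 1 + j) (n * n)); [lia | ring].
Qed.

Lemma block_vector_out : forall c n y k, (k < n * n \/ n * n + n < k)%nat ->
  block_vector c n y k = RtoC 0.
Proof.
  intros c n y k Hk.
  change (RtoC c * delta (n * n) k + RtoC c * place n y k = RtoC 0)%C.
  rewrite place_out by lia. unfold delta. destruct (Nat.eq_dec k (n * n)); [lia | ring].
Qed.

Section Composition.

Context {E F G : NormedModule C_AbsRing}.

Lemma holo_comp : forall (V : E -> Prop) (W : F -> Prop) (f : F -> G) (k : E -> F),
  holomorphic_on W f -> holomorphic_on V k -> (forall x, V x -> W (k x)) ->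
  holomorphic_on V (fun x => f (k x)).
Proof.
  intros V W f k Hf Hk HVW x Hx.
  destruct (Hk x Hx) as [lk Hlk]. destruct (Hf (k x) (HVW x Hx)) as [lf Hlf].
  exists (fun u => lf (lk u)). now apply filterdiff_comp'.
Qed.

Lemma holo_linear : forall (V : E -> Prop) (l : E -> F), is_linear l -> holomorphic_on V l.
Proof. intros V l Hl x _. exists l. now apply filterdiff_linear. Qed.

End Composition.

Lemma holo_block_vector : forall (E : NormedModule C_AbsRing) (V : E -> Prop) c n (k : E -> ell2),
  holomorphic_on (F := ell2_NormedModule) V k ->
  holomorphic_on (F := ell2_NormedModule) V (fun x => block_vector c n (k x)).
Proof.
  intros E V c n k Hk. unfold block_vector.
  apply (holo_plus (F := ell2_NormedModule)); [apply holo_const|].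
  apply (holo_scal (F := ell2_NormedModule)).
  apply (holo_comp (F := ell2_NormedModule) (G := ell2_NormedModule) V (fun _ => True)); auto.
  apply holo_linear, is_linear_place.
Qed.

Lemma is_linear_eval : forall x, unit_ball x ->
  is_linear (U := @Hinf_NormedModule ell2_NormedModule) (V := ell2_NormedModule)
    (fun h : Hinf_ell2 => h x).
Proof.
  intros x Hx. split; try easy.
  exists 1. split; [lra|]. intros h. rewrite Rmult_1_l. now apply Hinf_norm_ub.
Qed.

(** * Quadratic forms that read one coordinate of a block *)

(** The condition that the root exceeds [j] guarantees that the position i^2 + 1 + j lies inside the
    [i]-th block. *)
Definition square_past (j k : nat) : bool :=
  ((Nat.sqrt k * Nat.sqrt k =? k) && (j <? Nat.sqrt k))%nat%bool.

Lemma square_past_true : forall j k, square_past j k = true ->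
  exists i, (j < i)%nat /\ k = (i * i)%nat.
Proof.
  intros j k H. apply andb_prop in H. destruct H as [H1 H2].
  apply Nat.eqb_eq in H1. apply Nat.ltb_lt in H2. now exists (Nat.sqrt k).
Qed.

Lemma square_past_square : forall j n, (j < n)%nat -> square_past j (n * n) = true.
Proof.
  intros j n H. unfold square_past. rewrite Nat.sqrt_square, Nat.eqb_refl. simpl.
  now apply Nat.ltb_lt.
Qed.

(* Truncation at i^2 < N of the sum over i > j of u_(i^2) * v_(i^2 + 1 + j). *)
Fixpoint block_form (j N : nat) (u v : nat -> C) : C :=
  match N with
  | O => RtoC 0
  | S N => (block_form j N u v + if square_past j N then u N * v (N + 1 + j)%nat else RtoC 0)%C
  end.

Fixpoint sum_sqr (s N : nat) (u : nat -> C) : R :=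
  match N with
  | O => 0
  | S N => sum_sqr s N u + Cmod (u (N + s)%nat) ^ 2
  end.

(** The partial sum and the tail behind it add up to the tail from [s], and tails of a nonnegative
    series decrease. *)
Lemma sum_sqr_le : forall s N (u : ell2), sum_sqr s N u <= norm u ^ 2.
Proof.
  intros s N u. change (sum_sqr s N u <= ell2_norm u ^ 2). rewrite ell2_norm_sqr.
  set (tail := fun m => Series (fun k => Cmod (u (m + k)%nat) ^ 2)).
  assert (Hex : forall m, ex_series (fun k => Cmod (u (m + k)%nat) ^ 2)).
  { intros m. apply (ex_series_incr_n (fun k => Cmod (u k) ^ 2)). apply coef_summable. }
  assert (Hpos : forall m, 0 <= tail m).
  { intros m. apply Series_pos; [intros k; apply pow2_ge_0 | apply Hex]. }
  assert (Hrec : forall m, tail m = Cmod (u m) ^ 2 + tail (S m)).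
  { intros m. unfold tail. rewrite Series_incr_1 by apply Hex. f_equal.
    - now rewrite Nat.add_0_r.
    - apply Series_ext. intros k. do 3 f_equal. lia. }
  assert (H : forall n, sum_sqr s n u + tail (n + s)%nat = tail s).
  { induction n as [|n IH]; simpl; [unfold tail; ring|].
    rewrite <- IH, (Hrec (n + s)%nat). simpl. ring. }
  assert (Hs : tail s <= tail 0%nat).
  { clear H. induction s as [|s IH]; [apply Rle_refl|].
    eapply Rle_trans; [|exact IH]. rewrite (Hrec s).
    assert (P := pow2_ge_0 (Cmod (u s))). lra. }
  specialize (H N). specialize (Hpos (N + s)%nat). unfold tail at 2 in Hs. simpl in Hs.
  change (tail s <= Series (fun n => Cmod (u n) ^ 2)) in Hs. lra.
Qed.

(** A weighted arithmetic-geometric inequality, term by term, in place of Cauchy-Schwarz. The weight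
    [t] is free: 1 gives boundedness on the ball, while weights matched to the size of one argument
    give uniform continuity. *)
Lemma block_form_le : forall j N (u v : ell2) t, 0 < t ->
  Cmod (block_form j N u v) <= norm u ^ 2 * (t / 2) + norm v ^ 2 / (2 * t).
Proof.
  intros j N u v t Ht.
  apply Rle_trans with (sum_sqr 0 N u * (t / 2) + sum_sqr (S j) N v / (2 * t)).
  - induction N as [|N IH]; simpl block_form; simpl sum_sqr.
    + rewrite Cmod_0. unfold Rdiv. lra.
    + rewrite Nat.add_0_r. replace (N + S j)%nat with (N + 1 + j)%nat by lia.
      eapply Rle_trans; [apply Cmod_triangle|].
      set (x := Cmod (u N)). set (y := Cmod (v (N + 1 + j)%nat)).
      assert (Hxy : x * y <= x ^ 2 * (t / 2) + y ^ 2 / (2 * t)).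
      { assert (E : x ^ 2 * (t / 2) + y ^ 2 / (2 * t) - x * y = (t * x - y) ^ 2 * / (2 * t))
          by (field; lra).
        assert (0 <= (t * x - y) ^ 2 * / (2 * t)).
        { apply Rmult_le_pos; [apply pow2_ge_0|]. left. apply Rinv_0_lt_compat. lra. }
        lra. }
      assert (Hterm : Cmod (if square_past j N then u N * v (N + 1 + j)%nat else RtoC 0)
                        <= x * y).
      { destruct (square_past j N); [rewrite Cmod_mult; apply Rle_refl|].
        rewrite Cmod_0. apply Rmult_le_pos; apply Cmod_ge_0. }
      lra.
  - apply Rplus_le_compat; apply Rmult_le_compat_r; try apply sum_sqr_le; try lra.
    left. apply Rinv_0_lt_compat. lra.
Qed.

Lemma block_form_diff : forall j N (u v : ell2),
  (block_form j N u u - block_form j N v v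
   = block_form j N (minus u v) u + block_form j N v (minus u v))%C.
Proof.
  intros j N u v.
  assert (Hd : forall k, minus u v k = (u k - v k)%C) by reflexivity.
  set (d := minus u v) in *. clearbody d.
  induction N as [|N IH]; simpl block_form; [ring|].
  destruct (square_past j N).
  - replace (block_form j N u u + u N * u (N + 1 + j)%nat
             - (block_form j N v v + v N * v (N + 1 + j)%nat))%C
      with (block_form j N u u - block_form j N v v
            + (u N * u (N + 1 + j)%nat - v N * v (N + 1 + j)%nat))%C by ring.
    rewrite IH, !Hd. ring.
  - rewrite !Cplus_0_r. exact IH.
Qed.

Lemma holo_block_form : forall j N,
  holomorphic_on (E := ell2_NormedModule) (F := C_NormedModule) unit_ball
    (fun z : ell2 => block_form j N z z).
Proof.
  intros j N.
  assert (Hc : forall n, holomorphic_on (E := ell2_NormedModule) (F := C_NormedModule) unit_ball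
                           (fun z : ell2 => z n)).
  { intros n. replace (fun z : ell2 => z n) with (fun z : ell2 => inner z (basis n)).
    - apply holo_coord.
    - apply functional_extensionality. intros z. apply inner_basis. }
  induction N as [|N IH]; simpl.
  - apply holo_const.
  - apply (holo_plus (F := C_NormedModule)); [exact IH|].
    destruct (square_past j N); [|apply holo_const].
    apply (holo_mult (E := ell2_NormedModule)); apply Hc.
Qed.

(* Only the term of index n^2 of the form sees a perturbation in the n-th block. *)
Lemma block_form_perturb : forall j n c (w y : ell2) N, (j < n)%nat -> (n * n < N)%nat ->
  (block_form j N (plus w (block_vector c n y)) (plus w (block_vector c n y))
   = block_form j N w w + RtoC c * (w (n * n + 1 + j)%nat + y j * w (n * n)%nat
                                    + RtoC c * y j))%C.
Proof.
  intros j n c w y N Hj HN.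
  set (D := (RtoC c * (w (n * n + 1 + j)%nat + y j * w (n * n)%nat + RtoC c * y j))%C).
  assert (Hz : forall k, plus w (block_vector c n y) k = (w k + block_vector c n y k)%C)
    by reflexivity.
  set (z := plus w (block_vector c n y)) in *. clearbody z.
  (* Induction on the truncation: the two forms agree up to the index [n * n], and the single term
     there adds [D] once and for all. *)
  assert (H : forall m, (block_form j m z z
     = block_form j m w w + if le_lt_dec m (n * n) then RtoC 0 else D)%C).
  { induction m as [|m IH].
    - simpl. ring.
    - simpl block_form. rewrite IH, !Hz.
      destruct (Nat.eq_dec m (n * n)) as [E|E].
      + subst m. rewrite square_past_square by easy.
        rewrite block_vector_marker, block_vector_in by easy.
        destruct (le_lt_dec (n * n) (n * n)); [|lia].
        destruct (le_lt_dec (S (n * n)) (n * n)); [lia|]. unfold D. ring.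
      + destruct (square_past j m) eqn:Hs.
        * destruct (square_past_true j m Hs) as [i [Hi Ei]]. subst m.
          assert (Ei : (i < n \/ n < i)%nat) by (destruct (lt_eq_lt_dec i n) as [[|]|]; [lia | subst; easy | lia]).
          (* For another square i^2 the positions from i^2 to i^2 + i miss the [n]-th block, so
             neither factor of that term is perturbed; i^2 + 1 + j is among them because j < i. *)
          assert (Hb : (i * i + i < n * n \/ n * n + n < i * i)%nat) by nia.
          rewrite !block_vector_out by lia.
          destruct (le_lt_dec (i * i) (n * n)); destruct (le_lt_dec (S (i * i)) (n * n));
            try lia; ring.
        * destruct (le_lt_dec m (n * n)); destruct (le_lt_dec (S m) (n * n)); try lia; ring. }
  rewrite H. destruct (le_lt_dec N (n * n)); [lia | easy].
Qed.

Lemma ell2_coef_lim : forall (w : ell2) eps, 0 < eps ->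
  exists N, forall n, (N <= n)%nat -> Cmod (w n) < eps.
Proof.
  intros w eps He. assert (H := ex_series_lim_0 _ (coef_summable w)).
  apply is_lim_seq_spec in H. destruct (H (mkposreal (eps ^ 2) ltac:(apply pow_lt; lra))) as [N HN].
  exists N. intros n Hn. specialize (HN n Hn). simpl in HN.
  rewrite Rminus_0_r, Rabs_pos_eq in HN.
  - apply Rsqr_incrst_0; [unfold Rsqr; lra | apply Cmod_ge_0 | lra].
  - rewrite Rmult_1_r. assert (P := pow2_ge_0 (Cmod (w n))). simpl in P. lra.
Qed.

(** * The homomorphisms *)

Section Construction.

Variable U : (nat -> Prop) -> Prop.
Hypothesis U_proper : ProperFilter U.
Hypothesis U_ultra : forall P, U P \/ U (fun n => ~ P n).
Hypothesis U_free : forall P, eventually P -> U P.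

Lemma block_form_bounded : forall j N (z : ell2), unit_ball z -> Cmod (block_form j N z z) <= 1.
Proof.
  intros j N z Hz. assert (H := block_form_le j N z z 1 ltac:(lra)).
  unfold unit_ball in Hz. assert (P := norm_ge_0 z).
  assert (norm z ^ 2 <= 1) by nra. lra.
Qed.

Lemma block_form_is_ulim : forall j (z : ell2), unit_ball z ->
  is_ulim U (fun N => block_form j N z z) (ulim U (fun N => block_form j N z z)).
Proof.
  intros j z Hz. apply ulim_correct with 1; auto. intros N. now apply block_form_bounded.
Qed.

Lemma block_functional_uc : forall j,
  unif_continuous_on (E := ell2_NormedModule) (F := C_NormedModule) unit_ball
    (fun z : ell2 => ulim U (fun N => block_form j N z z)).
Proof.
  intros j eps He. exists (eps / 4). split; [lra|]. intros x y Hx Hy Hxy.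
  set (t := eps / 4) in *. assert (Ht : 0 < t) by (unfold t; lra).
  change (Cmod (ulim U (fun N => block_form j N x x) - ulim U (fun N => block_form j N y y)) < eps).
  set (a := ulim U (fun N => block_form j N x x)). set (b := ulim U (fun N => block_form j N y y)).
  apply Rle_lt_trans with (2 * t); [|unfold t; lra].
  replace (a - b)%C with (a + RtoC (-1) * b - RtoC 0)%C by ring.
  apply (is_ulim_dist U U_proper
           (fun N => block_form j N x x + RtoC (-1) * block_form j N y y)%C).
  - apply is_ulim_plus; auto; [now apply block_form_is_ulim|].
    apply is_ulim_mult; auto; [now apply is_ulim_const | now apply block_form_is_ulim].
  - apply filter_forall. intros N.
    replace (block_form j N x x + RtoC (-1) * block_form j N y y - RtoC 0)%C
      with (block_form j N x x - block_form j N y y)%C by ring.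
    rewrite block_form_diff. eapply Rle_trans; [apply Cmod_triangle|].
    (* The small difference occurs once in each argument. The weights 1/t and t balance its norm,
       below [t], against the norm 1 of the other argument, so each form is at most [t]. *)
    assert (H1 := block_form_le j N (minus x y) x (/ t) ltac:(now apply Rinv_0_lt_compat)).
    assert (H2 := block_form_le j N y (minus x y) t Ht).
    assert (Hd : norm (minus x y) < t) by exact Hxy.
    assert (Pd := norm_ge_0 (minus x y)). assert (Px := norm_ge_0 x). assert (Py := norm_ge_0 y).
    unfold unit_ball in Hx, Hy.
    set (d := norm (minus x y)) in *.
    assert (Ed : d ^ 2 <= t ^ 2) by (apply pow_incr; lra).
    assert (Ex : norm x ^ 2 <= 1) by nra. assert (Ey : norm y ^ 2 <= 1) by nra.
    assert (B1 : d ^ 2 * (/ t / 2) <= t / 2).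
    { replace (t / 2) with (t ^ 2 * (/ t / 2)) by (field; lra).
      apply Rmult_le_compat_r; [|easy].
      assert (0 < / t) by now apply Rinv_0_lt_compat. lra. }
    assert (B2 : d ^ 2 / (2 * t) <= t / 2).
    { replace (d ^ 2 / (2 * t)) with (d ^ 2 * (/ t / 2)) by (field; lra). exact B1. }
    assert (B3 : norm x ^ 2 / (2 * / t) <= t / 2).
    { replace (norm x ^ 2 / (2 * / t)) with (norm x ^ 2 * (t / 2)) by (field; lra). nra. }
    assert (B4 : norm y ^ 2 * (t / 2) <= t / 2) by nra.
    replace (2 * t) with (t + t) by ring.
    apply Rplus_le_compat; [eapply Rle_trans; [exact H1 | lra] | eapply Rle_trans; [exact H2 | lra]].
Qed.

(** Passing to the infinite sum along [U] makes holomorphy an instance of [holo_ulim] for the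
    truncations, which are polynomials in finitely many coordinates. *)
Definition block_functional (j : nat) : Au :=
  MkAu (ball_restr (fun z : ell2 => ulim U (fun N => block_form j N z z)))
    (holo_ball_restr (E := ell2_NormedModule) (F := C_NormedModule) _
       (holo_ulim U U_proper U_ultra (fun N (z : ell2_NormedModule) => block_form j N z z) 1
          (holo_block_form j) (block_form_bounded j)))
    (uc_ball_restr _ (block_functional_uc j))
    (ball_restr_off _).

Section LimitHom.

Variable z : nat -> ell2 -> ell2.
Hypothesis z_holo : forall n,
  holomorphic_on (E := ell2_NormedModule) (F := ell2_NormedModule) unit_ball (z n).
Hypothesis z_ball : forall n x, unit_ball x -> unit_ball (z n x).

Lemma limit_is_ulim : forall (f : Au) x, unit_ball x ->
  is_ulim U (fun n => f (z n x)) (ulim U (fun n => f (z n x))).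
Proof.
  intros f x Hx. destruct (uc_bounded f (Au_uc f)) as [M HM].
  apply (ulim_correct U U_proper U_ultra _ M). intros n. exact (HM _ (z_ball n x Hx)).
Qed.

Lemma limit_holo : forall f : Au,
  holomorphic_on (E := ell2_NormedModule) (F := C_NormedModule) unit_ball
    (fun x => ulim U (fun n => f (z n x))).
Proof.
  intros f. destruct (uc_bounded f (Au_uc f)) as [M HM].
  apply (holo_ulim U U_proper U_ultra (fun n (x : ell2_NormedModule) => f (z n x)) M).
  - intros n. apply (holo_comp (F := ell2_NormedModule) _ unit_ball); auto using Au_holo.
  - intros n x Hx. exact (HM _ (z_ball n x Hx)).
Qed.

Lemma limit_bounded : forall f : Au,
  bounded_on (E := ell2_NormedModule) (F := C_NormedModule) unit_ball
    (fun x => ulim U (fun n => f (z n x))).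
Proof.
  intros f. destruct (uc_bounded f (Au_uc f)) as [M HM]. exists M. intros x Hx.
  change (Cmod (ulim U (fun n => f (z n x))) <= M).
  replace (ulim U (fun n => f (z n x))) with (ulim U (fun n => f (z n x)) - RtoC 0)%C by ring.
  apply (is_ulim_dist U U_proper _ _ _ _ (limit_is_ulim f x Hx)).
  apply filter_forall. intros n. replace (f (z n x) - RtoC 0)%C with (f (z n x)) by ring.
  exact (HM _ (z_ball n x Hx)).
Qed.

Definition limit_map (f : Au) : HinfC :=
  MkHinf (F := C_NormedModule) (ball_restr (fun x => ulim U (fun n => f (z n x))))
    (holo_ball_restr _ (limit_holo f)) (bounded_ball_restr _ (limit_bounded f))
    (ball_restr_off _).

Lemma limit_map_in : forall f x, unit_ball x -> limit_map f x = ulim U (fun n => f (z n x)).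
Proof. intros f x Hx. exact (ball_restr_in (F := C_NormedModule) _ x Hx). Qed.

Lemma limit_map_off : forall f x, ~ unit_ball x -> limit_map f x = RtoC 0.
Proof. intros f x Hx. exact (Hinf_off (limit_map f) x Hx). Qed.

(** Evaluation at each [z n x] is multiplicative and linear, and limits along [U] preserve sums and
    products. *)
Lemma limit_map_hom : algebra_hom limit_map.
Proof.
  split; [|split].
  - intros f g. apply Hinf_ext. intros x.
    change (limit_map (plus f g) x = limit_map f x + limit_map g x)%C.
    destruct (classic (unit_ball x)) as [Hx|Hx].
    + rewrite !limit_map_in by easy. apply ulim_eq; auto.
      apply is_ulim_plus; auto; now apply limit_is_ulim.
    + rewrite !limit_map_off by easy. exact (eq_sym (Cplus_0_l (RtoC 0))).
  - intros k f. apply Hinf_ext. intros x.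
    change (limit_map (scal k f) x = k * limit_map f x)%C.
    destruct (classic (unit_ball x)) as [Hx|Hx].
    + rewrite !limit_map_in by easy. apply ulim_eq; auto.
      apply (is_ulim_mult U U_proper (fun _ => k)); [now apply is_ulim_const | now apply limit_is_ulim].
    + rewrite !limit_map_off by easy. exact (eq_sym (Cmult_0_r k)).
  - intros f g. apply Hinf_ext. intros x.
    change (limit_map (mult f g) x = limit_map f x * limit_map g x)%C.
    destruct (classic (unit_ball x)) as [Hx|Hx].
    + rewrite !limit_map_in by easy. apply ulim_eq; auto.
      apply is_ulim_mult; auto; now apply limit_is_ulim.
    + rewrite !limit_map_off by easy. exact (eq_sym (Cmult_0_r (RtoC 0))).
Qed.

Lemma limit_map_nonzero : exists f, limit_map f <> zero.
Proof.
  exists Au_one. intros H.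
  assert (E : limit_map Au_one zero = RtoC 0) by (rewrite H; reflexivity).
  assert (H0 := unit_ball_zero (E := ell2_NormedModule)).
  rewrite limit_map_in in E by exact H0.
  rewrite (ulim_eq U U_proper _ (RtoC 1)) in E.
  - injection E. lra.
  - apply (is_ulim_ext U U_proper (fun _ => RtoC 1)); [|now apply is_ulim_const].
    apply filter_forall. intros n. symmetry.
    exact (ball_restr_in (F := C_NormedModule) (fun _ => RtoC 1) _ (z_ball n _ H0)).
Qed.

Definition limit_hom : spectrum := Spectrum limit_map limit_map_hom limit_map_nonzero.

End LimitHom.

(** * The map into the fiber over g *)

Variable g : Hinf_ell2.
Hypothesis g_norm : norm g < 1.

(** A block vector built from a point of the ball has norm at most 2c, and |g| + 2c < 1. *)
Let c := (1 - norm g) / 3.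

(** The map to be built is a total function, but the points [g x + v_n (h x)] are guaranteed to lie
    in the ball only for [h] in the unit ball; any other [h] is replaced by zero. *)
Definition clip (h : Hinf_ell2) : Hinf_ell2 := if Rlt_dec (norm h) 1 then h else zero.

Lemma clip_ball : forall h, unit_ball (clip h).
Proof.
  intros h. unfold clip. destruct (Rlt_dec (norm h) 1); [easy|].
  exact (unit_ball_zero (E := @Hinf_NormedModule ell2_NormedModule)).
Qed.

Lemma clip_in : forall h, unit_ball h -> clip h = h.
Proof. intros h H. unfold clip. now destruct (Rlt_dec (norm h) 1). Qed.

Definition approach (h : Hinf_ell2) (n : nat) (x : ell2) : ell2 :=
  plus (g x) (block_vector c n (h x)).

Lemma c_pos : 0 < c.
Proof. unfold c. lra. Qed.

Lemma approach_ball : forall h n x, unit_ball h -> unit_ball x -> unit_ball (approach h n x).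
Proof.
  intros h n x Hh Hx. assert (Hc := c_pos).
  assert (H1 : norm (approach h n x) <= norm (g x) + norm (block_vector c n (h x)))
    by exact (ell2_norm_triangle (g x) (block_vector c n (h x))).
  assert (H2 := norm_block_vector c n (h x) (Rlt_le _ _ Hc)).
  assert (H3 : norm (g x) <= norm g) by exact (Hinf_norm_ub g x Hx).
  assert (H4 : norm (h x) <= norm h) by exact (Hinf_norm_ub h x Hx).
  unfold unit_ball in Hh |- *.
  assert (H5 : c * norm (h x) <= c * 1) by (apply Rmult_le_compat_l; lra).
  unfold c in *. lra.
Qed.

Lemma approach_holo_x : forall h n,
  holomorphic_on (E := ell2_NormedModule) (F := ell2_NormedModule) unit_ball (approach h n).
Proof.
  intros h n. apply (holo_plus (F := ell2_NormedModule)); [apply Hinf_holo|].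
  apply holo_block_vector, Hinf_holo.
Qed.

Lemma approach_holo_h : forall n x, unit_ball x ->
  holomorphic_on (E := @Hinf_NormedModule ell2_NormedModule) (F := ell2_NormedModule) unit_ball
    (fun h => approach h n x).
Proof.
  intros n x Hx. apply (holo_plus (F := ell2_NormedModule)); [apply holo_const|].
  apply holo_block_vector. now apply holo_linear, is_linear_eval.
Qed.

Definition fiber_map (h : Hinf_ell2) : spectrum :=
  limit_hom (approach (clip h)) (approach_holo_x (clip h))
    (fun n x Hx => approach_ball (clip h) n x (clip_ball h) Hx).

Lemma fiber_map_in : forall h f x, unit_ball h -> unit_ball x ->
  fiber_map h f x = ulim U (fun n => f (approach h n x)).
Proof.
  intros h f x Hh Hx. unfold fiber_map. simpl spectrum_fun.
  rewrite limit_map_in by easy. now rewrite clip_in.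
Qed.

Lemma fiber_map_fiber : forall h, unit_ball h -> fiber g (fiber_map h).
Proof.
  intros h Hh x Hx m. unfold xi. rewrite fiber_map_in by easy.
  apply ulim_eq; auto.
  apply (is_ulim_ext U U_proper (fun _ => g x m)); [|now apply is_ulim_const].
  (* For n > m the [n]-th block starts at n^2 > m, so the coordinate [m] is not perturbed. *)
  apply U_free. exists (S m). intros n Hn. symmetry.
  transitivity (inner (approach h n x) (basis m)).
  { exact (ball_restr_in (F := C_NormedModule) (fun y => inner y (basis m)) _
             (approach_ball h n x Hh Hx)). }
  rewrite inner_basis.
  change (g x m + block_vector c n (h x) m = g x m)%C.
  rewrite block_vector_out by nia. ring.
Qed.

Lemma fiber_map_analytic : analytic_on_ball fiber_map.
Proof.
  intros f x Hx h0 Hh0. destruct (uc_bounded f (Au_uc f)) as [M HM].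
  assert (H := holo_ulim U U_proper U_ultra
     (fun n (h : @Hinf_NormedModule ell2_NormedModule) => f (approach h n x)) M).
  destruct H with h0 as [l Hl]; auto.
  - intros n. apply (holo_comp (F := ell2_NormedModule) _ unit_ball).
    + apply Au_holo.
    + now apply approach_holo_h.
    + intros h Hh. now apply approach_ball.
  - intros n h Hh. exact (HM _ (approach_ball h n x Hh Hx)).
  (* The unit ball is open, so [clip] is the identity near [h0] and does not affect
     differentiability there. *)
  - exists l. apply filterdiff_ext_locally with (2 := Hl).
    generalize (locally_unit_ball h0 Hh0). apply filter_imp.
    intros h Hh. symmetry. now apply fiber_map_in.
Qed.

(** The perturbation identity has cross terms, each with a coordinate of [g x] near the position
    n^2. These vanish in the limit, and only the product of the marker with the moved coordinate
    survives. *)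
Lemma fiber_map_block_functional : forall h x j, unit_ball h -> unit_ball x ->
  fiber_map h (block_functional j) x
  = (ulim U (fun N => block_form j N (g x) (g x)) + RtoC c * (RtoC c * h x j))%C.
Proof.
  intros h x j Hh Hx. rewrite fiber_map_in by easy.
  assert (Hg : unit_ball (g x)).
  { unfold unit_ball. apply Rle_lt_trans with (norm g); [exact (Hinf_norm_ub g x Hx) | easy]. }
  set (B := ulim U (fun N => block_form j N (g x) (g x))).
  apply ulim_eq; auto.
  apply (is_ulim_ext U U_proper (fun n => B + RtoC c *
    (g x (n * n + 1 + j)%nat + h x j * g x (n * n)%nat + RtoC c * h x j))%C).
  (* Two thresholds occur: n > j, so that the [n]-th block contains the coordinate [j], and then for
     fixed [n] a truncation N > n^2, so that the form includes the term of that block. *)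
  - apply U_free. exists (S j). intros n Hn. symmetry.
    transitivity (ulim U (fun N => block_form j N (approach h n x) (approach h n x))).
    { exact (ball_restr_in (F := C_NormedModule)
               (fun z : ell2 => ulim U (fun N => block_form j N z z)) _
               (approach_ball h n x Hh Hx)). }
    apply ulim_eq; auto.
    apply (is_ulim_ext U U_proper (fun N => block_form j N (g x) (g x) + RtoC c *
      (g x (n * n + 1 + j)%nat + h x j * g x (n * n)%nat + RtoC c * h x j))%C).
    + apply U_free. exists (S (n * n)). intros N HN. symmetry.
      apply block_form_perturb; lia.
    + apply is_ulim_plus; auto; [now apply block_form_is_ulim | now apply is_ulim_const].
  - assert (Hz : forall s, is_ulim U (fun n => g x (n * n + s)%nat) (RtoC 0)).
    { intros s eps He. destruct (ell2_coef_lim (g x) eps He) as [N HN].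
      apply U_free. exists N. intros n Hn.
      replace (g x (n * n + s)%nat - RtoC 0)%C with (g x (n * n + s)%nat) by ring.
      apply HN. nia. }
    replace (RtoC c * (RtoC c * h x j))%C
      with (RtoC c * (RtoC 0 + h x j * RtoC 0 + RtoC c * h x j))%C by ring.
    apply is_ulim_plus; auto; [now apply is_ulim_const|].
    apply is_ulim_mult; auto; [now apply is_ulim_const|].
    apply is_ulim_plus; auto; [|now apply is_ulim_const].
    apply is_ulim_plus; auto.
    + apply (is_ulim_ext U U_proper (fun n => g x (n * n + (1 + j))%nat)); [|apply Hz].
      apply filter_forall. intros n. f_equal. lia.
    + apply is_ulim_mult; auto; [now apply is_ulim_const|].
      apply (is_ulim_ext U U_proper (fun n => g x (n * n + 0)%nat)); [|apply Hz].
      apply filter_forall. intros n. f_equal. lia.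
Qed.

(** The value at [block_functional j] is a term depending on [g] alone plus c^2 times the coordinate
    [j] of [h x]; since c is nonzero, every coordinate of [h] is determined on the ball. *)
Lemma fiber_map_injective : forall h1 h2, unit_ball h1 -> unit_ball h2 ->
  fiber_map h1 = fiber_map h2 -> h1 = h2.
Proof.
  intros h1 h2 H1 H2 E. apply Hinf_ext. intros x.
  destruct (classic (unit_ball x)) as [Hx|Hx].
  - apply ell2_ext. intros j.
    assert (E1 := fiber_map_block_functional h1 x j H1 Hx).
    rewrite E, fiber_map_block_functional in E1 by easy.
    assert (Hc : RtoC c <> RtoC 0).
    { intros E0. injection E0. assert (Hc := c_pos). lra. }
    set (B := ulim U (fun N => block_form j N (g x) (g x))) in E1.
    replace (h1 x j) with ((B + RtoC c * (RtoC c * h1 x j) - B) / (RtoC c * RtoC c))%C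
      by (field; exact Hc).
    rewrite <- E1. field. exact Hc.
  - now rewrite (Hinf_off h1 x Hx), (Hinf_off h2 x Hx).
Qed.

End Construction.

Theorem theorem2p3 (g : Hinf_ell2) (hg : norm g < 1) :
  exists Psi : Hinf_ell2 -> spectrum,
    (forall h : Hinf_ell2, unit_ball h -> fiber g (Psi h)) /\
    analytic_on_ball Psi /\
    (forall h1 h2 : Hinf_ell2, unit_ball h1 -> unit_ball h2 -> Psi h1 = Psi h2 -> h1 = h2).
Proof.
  destruct free_ultrafilter as [U [HP [HU Hfree]]].
  exists (fiber_map U HP HU g hg). split; [|split].
  - now apply fiber_map_fiber.
  - apply fiber_map_analytic.
  - now apply fiber_map_injective.
Qed.
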